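(* Let $R=B[x;\sigma,\delta]_p$ be a Poisson-Cauchon extension with associated torus $\mathcal H$, where $B$ is a noetherian $\mathcal H$-Poisson-UFD, and let $\{u_i\mid i\in I\}$ be a list of the homogeneous Poisson-prime elements of $B$ up to taking associates. Then there are the following three possibilities for a list of the homogeneous Poisson-prime elements of $R$ up to taking associates: (i) $\{u_i\mid i\in I,\ i\neq i_0\}\sqcup\{v_{i_0}:=u_{i_0}x-c_\circ\}$ for some $i_0\in I$ and $c_\circ\in B$ such that $u_{i_0}^{-1}c_\circ$ is a nonzero homogeneous element of $B[u_{i_0}^{-1}]$ with the same $X(\mathcal H)$-degree as $x$; (ii) $\{u_i\mid i\in I\}\sqcup\{x\}$; (iii) $\{u_i\mid i\in I\}$.
   Context: $\mathbb K$ is a field of characteristic $0$; algebras are $\mathbb K$-algebras, derivations are $\mathbb K$-linear. A Poisson algebra is a commutative algebra with a Lie bracket $\{-,-\}$ that is a derivation in each variable; a Poisson domain is a Poisson algebra that is an integral domain; a Poisson ideal is an ideal $I$ with $\{R,I\}\subseteq I$. A Poisson action of a group is an action by algebra automorphisms preserving the bracket. A Poisson derivation $\sigma$ of $B$ is a derivation for both product and bracket; a Poisson $\sigma$-derivation is a derivation $\delta$ for the product with $\delta(\{a,b\})=\{\delta(a),b\}+\{a,\delta(b)\}+\sigma(a)\delta(b)-\delta(a)\sigma(b)$. The Poisson-Ore extension $B[x;\sigma,\delta]_p$ is the polynomial algebra $B[x]$ with the unique Poisson bracket extending that of $B$ and satisfying $\{x,b\}=\sigma(b)x+\delta(b)$.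 For a rational action of a torus $\mathcal H\cong(\mathbb K^* )^r$ on an algebra, the algebra is graded by the rational character group $X(\mathcal H)$ (written additively); homogeneous elements are the $\mathcal H$-eigenvectors and $0$, the degree being the eigenvalue. $\mathrm{Lie}\,\mathcal H\cong\mathbb K^r$ acts by the differential: if $a$ has degree $h\mapsto h_1^{u_1}\cdots h_r^{u_r}$, then $\xi\cdot a=(u_1\xi_1+\dots+u_r\xi_r)a$. A Poisson-Cauchon extension of a Poisson algebra $B$ is a Poisson-Ore extension $R=B[x;\sigma,\delta]_p$ equipped with a rational Poisson action of a torus $\mathcal H$ such that (i) $B$ is $\mathcal H$-stable and $x$ is an $\mathcal H$-eigenvector; (ii) $\delta$ is locally nilpotent; (iii) there is $h_\circ\in\mathrm{Lie}\,\mathcal H$ such that $\sigma=(h_\circ\cdot)|_B$ and the $h_\circ$-eigenvalue $\lambda_\circ$ of $x$ is nonzero. A Poisson-prime element of a Poisson domain $R$ is a nonzero $c$ with $\{c,R\}\subseteq Rc$ and $R/(c)$ a domain. An $\mathcal H$-Poisson-prime ideal is a proper $\mathcal H$-stable Poisson ideal $P$ such that $IJ\subseteq P$ implies $I\subseteq P$ or $J\subseteq P$ for all $\mathcal H$-stable Poisson ideals $I,J$. A Poisson domain with Poisson $\mathcal H$-action is an $\mathcal H$-Poisson-UFD if each nonzero $\mathcal H$-Poisson-prime ideal contains a Poisson-prime $\mathcal H$-eigenvector. *)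

(* Defs.v *)
From HB Require Import structures.
From mathcomp Require Import all_boot all_order all_algebra.
Set Implicit Arguments.
Unset Strict Implicit.
Unset Printing Implicit Defensive.
Import GRing.Theory.
Local Open Scope ring_scope.

(* K-algebras that are integral domains.                                      *)
#[short(type="idomainAlgType")]
HB.structure Definition IdomainAlgebra (K : pzRingType) :=
  {A of GRing.IntegralDomain A & GRing.Algebra K A}.

(* MathComp makes {poly B} an algebra over B only; polyAlg and fracAlg are    *)
(* copies of {poly B} and {fraction B} carrying the K-algebra structures      *)
(* inherited from B.                                                          *)
Definition polyAlg (K : fieldType) (B : idomainAlgType K) := {poly B}.

Local Set Warnings "-redundant-canonical-projection".

Section PolyAlg.
Variables (K : fieldType) (B : idomainAlgType K).

HB.instance Definition _ := GRing.IntegralDomain.copy (polyAlg B) {poly B}.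

Definition polyAlg_scale (k : K) (p : polyAlg B) : polyAlg B :=
  (k%:A : B)%:P * p.

Fact polyAlg_scaleA a b v :
  polyAlg_scale a (polyAlg_scale b v) = polyAlg_scale (a * b) v.
Proof. by rewrite /polyAlg_scale mulrA -polyCM mulr_algl scalerA. Qed.
Fact polyAlg_scale1 : left_id 1 polyAlg_scale.
Proof. by move=> v; rewrite /polyAlg_scale scale1r mul1r. Qed.
Fact polyAlg_scaleDr : right_distributive polyAlg_scale +%R.
Proof. by move=> a u v; rewrite /polyAlg_scale mulrDr. Qed.
Fact polyAlg_scaleDl v : {morph polyAlg_scale^~ v : a b / a + b}.
Proof. by move=> a b; rewrite /polyAlg_scale scalerDl rmorphD mulrDl. Qed.

HB.instance Definition _ := GRing.Zmodule_isLmodule.Build K (polyAlg B)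
  polyAlg_scaleA polyAlg_scale1 polyAlg_scaleDr polyAlg_scaleDl.

Fact polyAlg_scaleAl (k : K) (u v : polyAlg B) : k *: (u * v) = (k *: u) * v.
Proof. exact: mulrA. Qed.
HB.instance Definition _ :=
  GRing.Lmodule_isLalgebra.Build K (polyAlg B) polyAlg_scaleAl.

Fact polyAlg_scaleAr (k : K) (u v : polyAlg B) : k *: (u * v) = u * (k *: v).
Proof. exact: mulrCA. Qed.
HB.instance Definition _ :=
  GRing.Lalgebra_isAlgebra.Build K (polyAlg B) polyAlg_scaleAr.

End PolyAlg.

Definition fracAlg (K : fieldType) (B : idomainAlgType K) := {fraction B}.

Section FracAlg.
Variables (K : fieldType) (B : idomainAlgType K).

HB.instance Definition _ := GRing.Field.copy (fracAlg B) {fraction B}.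

Definition fracAlg_scale (k : K) (p : fracAlg B) : fracAlg B :=
  tofrac (k%:A : B) * p.

Fact fracAlg_scaleA a b v :
  fracAlg_scale a (fracAlg_scale b v) = fracAlg_scale (a * b) v.
Proof. by rewrite /fracAlg_scale mulrA -tofracM mulr_algl scalerA. Qed.
Fact fracAlg_scale1 : left_id 1 fracAlg_scale.
Proof. by move=> v; rewrite /fracAlg_scale scale1r tofrac1 mul1r. Qed.
Fact fracAlg_scaleDr : right_distributive fracAlg_scale +%R.
Proof. by move=> a u v; rewrite /fracAlg_scale mulrDr. Qed.
Fact fracAlg_scaleDl v : {morph fracAlg_scale^~ v : a b / a + b}.
Proof. by move=> a b; rewrite /fracAlg_scale scalerDl rmorphD mulrDl. Qed.

HB.instance Definition _ := GRing.Zmodule_isLmodule.Build K (fracAlg B)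
  fracAlg_scaleA fracAlg_scale1 fracAlg_scaleDr fracAlg_scaleDl.

Fact fracAlg_scaleAl (k : K) (u v : fracAlg B) : k *: (u * v) = (k *: u) * v.
Proof. exact: mulrA. Qed.
HB.instance Definition _ :=
  GRing.Lmodule_isLalgebra.Build K (fracAlg B) fracAlg_scaleAl.

Fact fracAlg_scaleAr (k : K) (u v : fracAlg B) : k *: (u * v) = u * (k *: v).
Proof. exact: mulrCA. Qed.
HB.instance Definition _ :=
  GRing.Lalgebra_isAlgebra.Build K (fracAlg B) fracAlg_scaleAr.

End FracAlg.

Definition polyAlgC (K : fieldType) (B : idomainAlgType K) (b : B) :
  polyAlg B := b%:P.
Definition polyAlgX (K : fieldType) (B : idomainAlgType K) : polyAlg B := 'X.
Arguments polyAlgX {K B}.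
Definition toFracAlg (K : fieldType) (B : idomainAlgType K) (b : B) :
  fracAlg B := tofrac b.

Section Derivations.
Variables (K : fieldType) (A : comAlgType K).

Definition is_derivation (d : A -> A) : Prop :=
  linear d /\ (forall a b, d (a * b) = d a * b + a * d b).

Record is_poisson_bracket (br : A -> A -> A) : Prop := {
  poisson_deriv_l : forall b, is_derivation (br^~ b);
  poisson_deriv_r : forall a, is_derivation (br a);
  poisson_alt : forall a, br a a = 0;
  poisson_jacobi : forall a b c,
    br a (br b c) + br b (br c a) + br c (br a b) = 0
}.

Definition is_poisson_derivation (br : A -> A -> A) (s : A -> A) : Prop :=
  is_derivation s /\ (forall a b, s (br a b) = br (s a) b + br a (s b)).

Definition is_poisson_sderivation (br : A -> A -> A) (s d : A -> A) : Prop :=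
  is_derivation d /\
  (forall a b, d (br a b) = br (d a) b + br a (d b) + s a * d b - d a * s b).

Definition locally_nilpotent (d : A -> A) : Prop :=
  forall a, exists n : nat, iter n d a = 0.

End Derivations.

Section Ideals.
Variable A : comNzRingType.
Implicit Types I J : A -> Prop.

Definition is_ideal I : Prop :=
  [/\ I 0, (forall a b, I a -> I b -> I (a + b)) & (forall a b, I b -> I (a * b))].

Definition subideal I J : Prop := forall a, I a -> J a.

Definition ideal_mul I J : A -> Prop := fun a =>
  exists (n : nat) (f g : 'I_n -> A),
    [/\ forall i, I (f i), forall i, J (g i) & a = \sum_i f i * g i].

Definition principal (c : A) : A -> Prop := fun a => exists q, a = q * c.

(* A/I is an integral domain, spelled out on representatives: the coset of a  *)
(* is zero iff a belongs to I.                                                *)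
Definition quotient_is_domain I : Prop :=
  ~ I 1 /\ (forall a b, I (a * b) -> I a \/ I b).

Definition noetherian : Prop :=
  forall I : nat -> A -> Prop,
    (forall n, is_ideal (I n)) -> (forall n, subideal (I n) (I n.+1)) ->
    exists N : nat, forall n, (N <= n)%N -> subideal (I n) (I N).

Definition is_poisson_ideal (br : A -> A -> A) I : Prop :=
  is_ideal I /\ (forall a b, I b -> I (br a b)).

Definition poisson_prime (br : A -> A -> A) (c : A) : Prop :=
  [/\ c != 0, (forall a, principal c (br c a)) & quotient_is_domain (principal c)].

End Ideals.

(* The torus (K^* )^r, as the row vectors with nonzero coordinates.           *)
Section Torus.
Variables (K : fieldType) (r : nat).

Record torus := Torus {
  torus_val :> 'rV[K]_r; torus_valP : [forall i, torus_val 0 i != 0] }.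

HB.instance Definition _ := [isSub for torus_val].
HB.instance Definition _ := [Choice of torus by <:].

Fact torus_one_subproof : [forall i, (const_mx 1 : 'rV[K]_r) 0 i != 0].
Proof. by apply/forallP=> i; rewrite mxE oner_eq0. Qed.
Definition torus_one := Torus torus_one_subproof.

Fact torus_inv_subproof (h : torus) :
  [forall i, (\row_j (h 0 j)^-1 : 'rV[K]_r) 0 i != 0].
Proof. by apply/forallP=> i; rewrite mxE invr_eq0 (forallP (torus_valP h)). Qed.
Definition torus_inv h := Torus (torus_inv_subproof h).

Fact torus_mul_subproof (g h : torus) :
  [forall i, (\row_j (g 0 j * h 0 j) : 'rV[K]_r) 0 i != 0].
Proof.
by apply/forallP=> i; rewrite mxE mulf_neq0 ?(forallP (torus_valP _)).
Qed.
Definition torus_mul g h := Torus (torus_mul_subproof g h).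

Fact torus_mulA : associative torus_mul.
Proof. by move=> f g h; apply/val_inj/rowP=> i; rewrite !mxE mulrA. Qed.
Fact torus_mul1 : left_id torus_one torus_mul.
Proof. by move=> h; apply/val_inj/rowP=> i; rewrite !mxE mul1r. Qed.
Fact torus_1mul : right_id torus_one torus_mul.
Proof. by move=> h; apply/val_inj/rowP=> i; rewrite !mxE mulr1. Qed.
Fact torus_mulV : left_inverse torus_one torus_inv torus_mul.
Proof.
move=> h; apply/val_inj/rowP=> i.
by rewrite !mxE mulVf // (forallP (torus_valP h)).
Qed.
Fact torus_Vmul : right_inverse torus_one torus_inv torus_mul.
Proof.
move=> h; apply/val_inj/rowP=> i.
by rewrite !mxE mulfV // (forallP (torus_valP h)).
Qed.
HB.instance Definition _ := isGroup.Build torus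
  torus_mulA torus_mul1 torus_1mul torus_mulV torus_Vmul.

(* X(H) is identified with Z^r: u is the character h |-> prod_i h_i^(u_i).    *)
Definition torus_char (u : 'rV[int]_r) (h : torus) : K :=
  \prod_i (h 0 i) ^ (u 0 i).

(* Regular functions on the torus: Laurent polynomials in the coordinates.    *)
Definition torus_regular (f : torus -> K) : Prop :=
  exists s : seq (K * 'rV[int]_r),
    forall h, f h = \sum_(m <- s) m.1 * torus_char m.2 h.

End Torus.

Section Actions.
Variables (K : fieldType) (r : nat) (A : comAlgType K).
Implicit Types (act : torus K r -> A -> A) (br : A -> A -> A).

Record is_poisson_action br act : Prop := {
  action_one : forall a, act 1%g a = a;
  action_mul : forall g h a, act (g * h)%g a = act g (act h a);
  action_linear : forall h, linear (act h);
  action_multiplicative : forall h, monoid_morphism (act h);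
  action_bracket : forall h a b, act h (br a b) = br (act h a) (act h b)
}.

(* Every element lies in a finite-dimensional stable subspace, with basis v,  *)
(* on which the torus acts by a morphism of algebraic groups h |-> M h.       *)
Definition is_rational_action act : Prop :=
  forall a, exists (n : nat) (v : 'I_n -> A) (M : torus K r -> 'M[K]_n),
    [/\ forall c : 'I_n -> K, \sum_i c i *: v i = 0 -> forall i, c i = 0,
        forall h j, act h (v j) = \sum_i M h i j *: v i,
        forall i j, torus_regular (fun h => M h i j)
      & exists c : 'I_n -> K, a = \sum_i c i *: v i].

Definition is_eigenvector act (a : A) : Prop :=
  a != 0 /\ exists chi : torus K r -> K, forall h, act h a = chi h *: a.

Definition homogeneous act (a : A) : Prop := a = 0 \/ is_eigenvector act a.

Definition has_degree act (u : 'rV[int]_r) (a : A) : Prop :=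
  forall h, act h a = torus_char u h *: a.

(* D is the action on A of the element xi of Lie H = K^r. For a rational      *)
(* action the homogeneous elements span A, so this determines D.              *)
Definition is_lie_action act (xi : 'rV[K]_r) (D : A -> A) : Prop :=
  linear D /\
  (forall u a, has_degree act u a ->
     D a = (\sum_i (u 0 i)%:~R * xi 0 i) *: a).

Definition is_stable act (I : A -> Prop) : Prop :=
  forall h a, I a -> I (act h a).

Definition is_stable_poisson_ideal br act (I : A -> Prop) : Prop :=
  is_poisson_ideal br I /\ is_stable act I.

Definition is_H_poisson_prime_ideal br act (P : A -> Prop) : Prop :=
  [/\ is_stable_poisson_ideal br act P, ~ P 1
    & forall I J : A -> Prop,
        is_stable_poisson_ideal br act I -> is_stable_poisson_ideal br act J ->
        subideal (ideal_mul I J) P -> subideal I P \/ subideal J P].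

Definition homogeneous_poisson_prime br act (c : A) : Prop :=
  poisson_prime br c /\ homogeneous act c.

End Actions.

Definition is_H_poisson_UFD (K : fieldType) (r : nat) (A : idomainAlgType K)
    (br : A -> A -> A) (act : torus K r -> A -> A) : Prop :=
  [/\ is_poisson_bracket br, is_poisson_action br act
    & forall P : A -> Prop, is_H_poisson_prime_ideal br act P ->
        (exists2 a, P a & a != 0) ->
        exists c, [/\ P c, poisson_prime br c & is_eigenvector act c]].

Definition associate (A : idomainType) (a b : A) : Prop :=
  exists2 w, w \is a GRing.unit & a = w * b.

(* The family u lists the elements satisfying P up to taking associates.      *)
Definition lists_up_to_associates (A : idomainType) (P : A -> Prop)
    (I : Type) (u : I -> A) : Prop :=
  [/\ forall i, P (u i),
      forall i j, associate (u i) (u j) -> i = j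
    & forall p, P p -> exists i, associate p (u i)].

Section PoissonCauchon.
Variables (K : fieldType) (r : nat) (B : idomainAlgType K).

(* brR is the only bracket on B[x] satisfying the last three conditions.       *)
Record is_poisson_ore (brB : B -> B -> B) (sigma delta : B -> B)
    (brR : polyAlg B -> polyAlg B -> polyAlg B) : Prop := {
  ore_bracketB : is_poisson_bracket brB;
  ore_sigma : is_poisson_derivation brB sigma;
  ore_delta : is_poisson_sderivation brB sigma delta;
  ore_bracketR : is_poisson_bracket brR;
  ore_extends : forall a b,
    brR (polyAlgC a) (polyAlgC b) = polyAlgC (brB a b);
  ore_X : forall b,
    brR polyAlgX (polyAlgC b)
    = polyAlgC (sigma b) * polyAlgX + polyAlgC (delta b)
}.

(* actB is the restriction to B of the action on R = B[x]; its existence is   *)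
(* the stability of B. Lie H acts on R through D.                             *)
Record is_poisson_cauchon (brB : B -> B -> B) (sigma delta : B -> B)
    (brR : polyAlg B -> polyAlg B -> polyAlg B)
    (actB : torus K r -> B -> B) (actR : torus K r -> polyAlg B -> polyAlg B) :
    Prop := {
  cauchon_ore : is_poisson_ore brB sigma delta brR;
  cauchon_action : is_poisson_action brR actR;
  cauchon_rational : is_rational_action actR;
  cauchon_stable : forall h b, actR h (polyAlgC b) = polyAlgC (actB h b);
  cauchon_X : is_eigenvector actR polyAlgX;
  cauchon_nilpotent : locally_nilpotent delta;
  cauchon_lie : exists (h0 : 'rV[K]_r) (D : polyAlg B -> polyAlg B) (lam : K),
    [/\ is_lie_action actR h0 D,
        forall b, D (polyAlgC b) = polyAlgC (sigma b),
        D polyAlgX = lam *: polyAlgX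
      & lam != 0]
}.

(* The extension to fractions of a torus action on B by automorphisms. For an *)
(* eigenvector u it preserves B[u^-1], seen inside the field of fractions.    *)
Definition frac_act (act : torus K r -> B -> B) (h : torus K r)
    (f : fracAlg B) : fracAlg B :=
  let q : {ratio B} := repr (f : {fraction B}) in
  toFracAlg (act h (\n_q)) / toFracAlg (act h (\d_q)).

End PoissonCauchon.

(* Main.v *)
Require Import Defs.
From HB Require Import structures.
From mathcomp Require Import all_boot all_order all_algebra.
From mathcomp Require Import generic_quotient boolp ring zify.
Set Implicit Arguments.
Unset Strict Implicit.
Unset Printing Implicit Defensive.
Import GRing.Theory.
Local Open Scope ring_scope.

(** Let [L] be the eigenvalue of [x] under the element of the Lie algebra that
acts on [B] as [sigma].

A homogeneous Poisson-prime of [R = B[x]] that is constant in [x] is a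
Poisson-prime [c] of [B] dividing [delta c], because
[{x, c} = sigma c * x + delta c] and [sigma c] is a multiple of [c]; such [c]
are called persistent below. A locally nilpotent derivation of a domain of
characteristic 0 kills every element that divides its image ([lnd_dvd_eq0]),
so [delta c = 0] for persistent [c]. The three cases are separated by whether
all the [u_i] are persistent, and then by whether [delta] is zero.

If [u = u_(i0)] is not persistent, a Poisson-prime of degree one is
[v = u x - c] with [c = L^-1 delta u]. Its origin is the deleting-derivation
map: with [n] maximal such that [delta^n u <> 0], the image of [u], cleared of
denominators, is
  [p = sum_(j <= n) (- 1 / L)^j / j! delta^j(u) x^(n - j)],
and [p] is Poisson-normal in [R]. This is proved one coefficient at a time
inside [B], by induction on the nilpotency index of the element bracketed with
[p] ([defect_eq0]). The coefficient of [x^(n - 1)] yields a formula for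
[n L u delta b] in terms of brackets with [u] and [delta u]
([delta_via_bracket]); at [b = u] and [b = delta u] this formula gives
[n u delta^2(u) = (n - 1) (delta u)^2], whence [n = 1], as [u] is a prime not
dividing [delta u] ([height_eq1]). The same formula then makes [v]
Poisson-normal and all the other [u_i] persistent: this is case (i).

Suppose that all the [u_i] are persistent. If [delta = 0], then [x] is
Poisson-prime: case (ii). If some homogeneous Poisson-prime [p] has degree
[d > 0] in [x], its leading coefficient [E] is Poisson-normal in [B]. As [B] is
a noetherian H-Poisson-UFD, a multiple of [E] is a product of Poisson-prime
eigenvectors ([stable_poisson_ideal_contains_prime_product]); [delta] kills
these, hence kills [E], its kernel being factorially closed. For the next
coefficient [a] of [p], normality gives [d E delta(a) = L a^2]. Since [delta]
strictly lowers the height [max {k | delta^k a <> 0}], which is additive on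
products, [a = 0]; and then normality reads [d E delta(b) = 0] for all [b]
([delta_eq0_of_high_normal]). So [delta <> 0] leaves only case (iii).

In cases (i) and (ii), the latter with [u = 1] and [v = x], there is no new
Poisson-prime besides [v]. Let [p] be a
homogeneous Poisson-normal element of positive degree in [x], and divide
[u^N p] by [v]. The remainder [s] lies in [B], and its brackets are related to
those of the leading coefficient of [u^N p] in a way that is incompatible with
their weights unless [s = 0] ([normal_pair_eq0]). So [v] divides [p].

Clearing denominators throughout keeps the arguments in [B] and [B[x]]
instead of the localization of [B] at its Poisson-primes. *)

(** * Locally nilpotent derivations *)

Lemma alg_natr_neq0 (K : fieldType) (A : idomainAlgType K) :
  [pchar K] =i pred0 -> forall n : nat, (0 < n)%N -> n%:R != 0 :> A.
Proof.
move=> charK0 n n_gt0.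
by rewrite -scaler_nat scaler_eq0 oner_eq0 orbF pcharf0P in charK0 *;
  rewrite charK0 -lt0n.
Qed.

Section DerivationTheory.
Variables (K : fieldType) (A : comAlgType K) (d : A -> A).
Hypothesis derd : is_derivation d.

Lemma derD a b : d (a + b) = d a + d b.
Proof. by have := derd.1 1 a b; rewrite !scale1r. Qed.

Lemma der0 : d 0 = 0.
Proof. by apply: (addrI (d 0)); rewrite -derD !addr0. Qed.

Lemma derZ k a : d (k *: a) = k *: d a.
Proof. by have := derd.1 k a 0; rewrite der0 !addr0. Qed.

Lemma derN a : d (- a) = - d a.
Proof. by rewrite -scaleN1r derZ scaleN1r. Qed.

Lemma derB a b : d (a - b) = d a - d b.
Proof. by rewrite derD derN. Qed.

Lemma derMn a n : d (a *+ n) = d a *+ n.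
Proof. by elim: n => [|n IH]; rewrite ?mulr0n ?der0 // !mulrS derD IH. Qed.

Lemma der_sum I (r : seq I) (P : pred I) (F : I -> A) :
  d (\sum_(i <- r | P i) F i) = \sum_(i <- r | P i) d (F i).
Proof. exact: (big_morph d derD der0). Qed.

Lemma derM a b : d (a * b) = d a * b + a * d b.
Proof. exact: derd.2. Qed.

Lemma der1 : d 1 = 0.
Proof.
by apply: (addrI (d 1)); rewrite addr0 -[in RHS](mulr1 1) derM mulr1 mul1r.
Qed.

Lemma der_alg (k : K) : d k%:A = 0.
Proof. by rewrite derZ der1 scaler0. Qed.

Lemma der_iter0 n : iter n d 0 = 0.
Proof. by elim: n => //= n ->; exact: der0. Qed.

Lemma der_iterD_eq0 n m a : iter n d a = 0 -> iter (m + n) d a = 0.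
Proof. by move=> da0; rewrite iterD da0 der_iter0. Qed.

Lemma der_leibniz n a b :
  iter n d (a * b)
  = \sum_(i < n.+1) (iter (n - i) d a * iter i d b) *+ 'C(n, i).
Proof.
elim: n => [|n IH]; first by rewrite big_ord1 /= bin0.
rewrite iterS IH der_sum.
under eq_bigr => i _ do
  rewrite derMn derM mulrnDl -!iterS -subSn -1?ltnS ?ltn_ord //.
rewrite big_split big_ord_recl [in RHS]big_ord_recl /= -addrA; congr (_ + _).
  by rewrite !bin0.
rewrite [X in _ + X]big_ord_recr [in RHS]big_ord_recr /= !subnn /bump /= add1n
  !binn.
rewrite addrA -big_split /=; congr (_ + _).
by apply: eq_bigr => i _; rewrite !add1n !subSS binS mulrnDr.
Qed.

End DerivationTheory.

Section LocallyNilpotent.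
Variables (K : fieldType) (A : idomainAlgType K) (d : A -> A).
Hypotheses (charK0 : [pchar K] =i pred0) (derd : is_derivation d).
Hypothesis nild : locally_nilpotent d.

Lemma lnd_height a : a != 0 ->
  exists n, iter n d a != 0 /\ iter n.+1 d a = 0.
Proof.
move=> a0; have [m dm] := nild a.
elim: m dm => [/= aE|m IH dm]; first by rewrite aE eqxx in a0.
by have [/IH//|dm0] := eqVneq (iter m d a) 0; exists m.
Qed.

(** In the Leibniz expansion of [d^(n + m) (a b)] only the term
[binomial(n + m, m) d^n(a) d^m(b)] survives, so heights add up on products. *)
Lemma lnd_height_mul n m a b :
  iter n d a != 0 -> iter n.+1 d a = 0 ->
  iter m d b != 0 -> iter m.+1 d b = 0 ->
  iter (n + m) d (a * b) != 0.
Proof.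
move=> an0 anS0 bm0 bmS0.
have mP : (m < (n + m).+1)%N by rewrite ltnS leq_addl.
rewrite (der_leibniz derd) (bigD1 (Ordinal mP)) //= big1 ?addr0 => [|i ni].
  rewrite addnK -mulr_natr !mulf_neq0 //.
  by rewrite alg_natr_neq0 // bin_gt0 leq_addl.
have [im|im|im] := ltngtP (val i) m; last by case/eqP: ni; apply/val_inj.
  have -> : (n + m - i = m - i.+1 + n.+1)%N by move: im => /= im; lia.
  by rewrite (der_iterD_eq0 derd) ?mul0r ?mul0rn.
rewrite -[X in iter X d b](subnK im).
by rewrite (der_iterD_eq0 derd) ?mulr0 ?mul0rn.
Qed.

(** If [d a = q a] were nonzero, its height would be at least that of [a],
whereas [d] lowers the height by one. *)
Lemma lnd_dvd_eq0 a : principal a (d a) -> d a = 0.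
Proof.
case=> q da; apply/eqP; apply: contraT => da0.
have a0 : a != 0 by apply: contraNneq da0 => ->; rewrite (der0 derd).
have q0 : q != 0 by apply: contraNneq da0 => q0; rewrite da q0 mul0r.
have [n [an anS]] := lnd_height a0; have [m [qm qmS]] := lnd_height q0.
have := lnd_height_mul qm qmS an anS; rewrite -da -iterSr.
by rewrite -addnS (der_iterD_eq0 derd) ?eqxx.
Qed.

(** The kernel consists of 0 and the elements of height 0, and heights add up
on products. *)
Lemma lnd_ker_factor a b : a * b != 0 -> d (a * b) = 0 -> d a = 0.
Proof.
rewrite mulf_eq0 negb_or => /andP[a0 b0] dab.
have [n [an anS]] := lnd_height a0; have [m [bm bmS]] := lnd_height b0.
case: n => [|n] in an anS; first exact: anS.
have := lnd_height_mul an anS bm bmS.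
by rewrite addSn iterSr dab (der_iter0 derd) eqxx.
Qed.

End LocallyNilpotent.

(** * Weights of a rational torus action *)

Section Characters.
Variables (K : fieldType) (r : nat).
Implicit Types (m : 'rV[int]_r) (h : torus K r).

Lemma torus_coord_neq0 h i : h 0 i != 0.
Proof. exact: (forallP (torus_valP h)). Qed.

Lemma torus_char_neq0 m h : torus_char m h != 0.
Proof. by apply/prodf_neq0 => i _; rewrite expfz_neq0 ?torus_coord_neq0. Qed.

Lemma torus_char1 m : torus_char m (1%g : torus K r) = 1.
Proof. by rewrite /torus_char big1 // => i _; rewrite mxE exp1rz. Qed.

Lemma torus_charM m g h :
  torus_char m (g * h)%g = torus_char m g * torus_char m h.
Proof.
by rewrite /torus_char -big_split; apply: eq_bigr => i _; rewrite mxE expfzMl.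
Qed.

Lemma torus_char0 h : torus_char 0 h = 1.
Proof. by rewrite /torus_char big1 // => i _; rewrite mxE expr0z. Qed.

Lemma torus_charD m1 m2 h :
  torus_char (m1 + m2) h = torus_char m1 h * torus_char m2 h.
Proof.
rewrite /torus_char -big_split; apply: eq_bigr => i _.
by rewrite mxE expfzDr ?torus_coord_neq0.
Qed.

Lemma torus_charN m h : torus_char (- m) h = (torus_char m h)^-1.
Proof.
apply: (mulfI (torus_char_neq0 m h)).
by rewrite -torus_charD subrr torus_char0 mulfV ?torus_char_neq0.
Qed.

Lemma torus_charMn m n h : torus_char (m *+ n) h = torus_char m h ^+ n.
Proof.
elim: n => [|n IH]; first by rewrite mulr0n torus_char0 expr0.
by rewrite mulrS torus_charD IH exprS.
Qed.

Hypothesis charK0 : [pchar K] =i pred0.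

Lemma expr2z_eq1 (z : int) : (2 : K) ^ z = 1 -> z = 0.
Proof.
have natP n : (2 : K) ^+ n = 1 -> n = 0%N.
  move=> e; have := (pcharf0P K).1 charK0 (2 ^ n - 1)%N.
  rewrite natrB ?expn_gt0 // natrX e subrr eqxx => /esym.
  by case: n {e} => // n; rewrite expnS subn_eq0; have := expn_gt0 2 n; lia.
case: z => n; first by rewrite -exprnP => /natP ->.
rewrite NegzE -exprnN => e; suff : n.+1 = 0%N by [].
by apply: natP; rewrite -[LHS]invrK e invr1.
Qed.

(** The point with one coordinate 2 and the others 1 reads off one exponent,
the powers of 2 being distinct in characteristic 0. *)
Lemma torus_char_inj m1 m2 :
  (forall h, torus_char m1 h = torus_char m2 h) -> m1 = m2.
Proof.
move=> e; apply/rowP => i; apply/eqP; rewrite -subr_eq0; apply/eqP.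
have two0 : (2 : K) != 0 by rewrite ((pcharf0P K).1 charK0 2).
pose t : 'rV[K]_r := \row_j (if j == i then 2 else 1).
have tP : [forall j, t 0 j != 0].
  by apply/forallP => j; rewrite mxE; case: ifP; rewrite ?oner_eq0.
have tE m : torus_char m (Torus tP) = 2 ^ m 0 i.
  rewrite /torus_char (bigD1 i) //= big1 => [|j /negPf ji].
    by rewrite mxE eqxx mulr1.
  by rewrite mxE ji exp1rz.
apply: expr2z_eq1; rewrite expfzDr // -[_ ^ - _]invr_expz -!tE e divff //.
exact: torus_char_neq0.
Qed.

(** Dedekind's argument: the relation at [g h] minus [torus_char m0 g] times
the relation at [h] is a relation in which [m0] no longer occurs. *)
Lemma torus_char_independent (A : lmodType K) (s : seq 'rV[int]_r)
    (w : 'rV[int]_r -> A) :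
  uniq s -> (forall h : torus K r, \sum_(m <- s) torus_char m h *: w m = 0) ->
  forall m, m \in s -> w m = 0.
Proof.
elim: s w => [//|m0 s IH] w /= /andP[m0s us] sum0.
have w0 m : m \in s -> w m = 0.
  move=> ms; have mm0 : m <> m0 by move=> e; rewrite -e ms in m0s.
  have [g gP] : exists g : torus K r, torus_char m g != torus_char m0 g.
    apply: contrapT => H; apply: mm0; apply: torus_char_inj => h.
    by apply/eqP; apply: contra_notT H => ?; exists h.
  have := IH (fun m => (torus_char m g - torus_char m0 g) *: w m) us.
  move=> /(_ _ m ms) H; apply/eqP.
  suff: (torus_char m g - torus_char m0 g) *: w m == 0.
    by rewrite scaler_eq0 subr_eq0 (negPf gP).
  rewrite H // => h; have := sum0 (g * h)%g;
    have /(congr1 ( *:%R (torus_char m0 g))) := sum0 h.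
  rewrite !big_cons scaler0 scalerDr scalerA torus_charM => e1 e2.
  have := congr2 (fun x y => x - y) e2 e1;
    rewrite subrr /= opprD addrACA subrr add0r scaler_sumr -sumrB.
  move=> e3; rewrite -[RHS]e3; apply: eq_bigr => k _.
  by rewrite torus_charM !scalerA -scalerBl; congr (_ *: _); ring.
move=> m; rewrite inE => /predU1P[->|]; last exact: w0.
have := sum0 1%g; rewrite big_cons torus_char1 scale1r big_seq big1 ?addr0 //.
by move=> k ks; rewrite w0 ?scaler0.
Qed.

End Characters.

Section Weights.
Variables (K : fieldType) (r : nat) (A : comAlgType K).
Variables (br : A -> A -> A) (act : torus K r -> A -> A).
Hypotheses (charK0 : [pchar K] =i pred0) (actP : is_poisson_action br act).
Implicit Types (m : 'rV[int]_r) (h : torus K r).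

Lemma actD h a b : act h (a + b) = act h a + act h b.
Proof. by have := action_linear actP h 1 a b; rewrite !scale1r. Qed.

Lemma act0 h : act h 0 = 0.
Proof. by apply: (addrI (act h 0)); rewrite -actD !addr0. Qed.

Lemma actZ h k a : act h (k *: a) = k *: act h a.
Proof. by have := action_linear actP h k a 0; rewrite act0 !addr0. Qed.

Lemma actN h a : act h (- a) = - act h a.
Proof. by rewrite -scaleN1r actZ scaleN1r. Qed.

Lemma act_sub h a b : act h (a - b) = act h a - act h b.
Proof. by rewrite actD actN. Qed.

Lemma act_sum h I (s : seq I) (P : pred I) (F : I -> A) :
  act h (\sum_(i <- s | P i) F i) = \sum_(i <- s | P i) act h (F i).
Proof. exact: (big_morph _ (actD h) (act0 h)). Qed.

Lemma actM h a b : act h (a * b) = act h a * act h b.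
Proof. exact: (action_multiplicative actP h).2. Qed.

Lemma act_1 h : act h 1 = 1.
Proof. exact: (action_multiplicative actP h).1. Qed.

Lemma act_inj h : injective (act h).
Proof.
move=> a b e; rewrite -(action_one actP a) -(action_one actP b) -(mulVg h).
by rewrite !(action_mul actP) e.
Qed.

Lemma has_degreeM m1 m2 a b :
  has_degree act m1 a -> has_degree act m2 b ->
  has_degree act (m1 + m2) (a * b).
Proof.
by move=> da db h; rewrite actM da db torus_charD -scalerAl -scalerAr scalerA.
Qed.

Lemma has_degreeX m n a :
  has_degree act m a -> has_degree act (m *+ n) (a ^+ n).
Proof.
move=> da; elim: n => [|n IH] h; last by rewrite mulrS exprS;
  apply: has_degreeM.
by rewrite expr0 act_1 mulr0n torus_char0 scale1r.
Qed.

Lemma has_degreeZ m k a : has_degree act m a -> has_degree act m (k *: a).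
Proof. by move=> da h; rewrite actZ da !scalerA mulrC. Qed.

Lemma has_degree0 m : has_degree act m 0.
Proof. by move=> h; rewrite act0 scaler0. Qed.

Lemma has_degree_alg k : has_degree act 0 k%:A.
Proof. by move=> h; rewrite actZ act_1 torus_char0 scale1r. Qed.

Lemma has_degree_br m1 m2 a b : is_poisson_bracket br ->
  has_degree act m1 a -> has_degree act m2 b ->
  has_degree act (m1 + m2) (br a b).
Proof.
move=> brP da db h; rewrite (action_bracket actP) da db torus_charD.
by rewrite (derZ (poisson_deriv_l brP _)) (derZ (poisson_deriv_r brP _))
  scalerA.
Qed.

Hypothesis ratP : is_rational_action act.

(** Matrix coefficients are Laurent polynomials, so [act h a] is a combination
of characters of [h] with coefficients in [A]. By independence of characters
these coefficients are weight vectors, and [h = 1] shows that they add up to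
[a]. *)
Lemma weight_decomposition a : exists s (w : 'rV[int]_r -> A),
  [/\ uniq s, forall m, has_degree act m (w m) & a = \sum_(m <- s) w m].
Proof.
have [n [v [M [_ Mv Mreg [c ac]]]]] := ratP a.
have [S SP] := choice (fun ij => Mreg ij.1 ij.2).
pose l := flatten [seq [seq (p.2, (p.1 * c ij.2) *: v ij.1) | p <- S ij]
                  | ij : 'I_n * 'I_n].
have actl h : act h a = \sum_(p <- l) torus_char p.1 h *: p.2.
  rewrite big_flatten big_image /= ac act_sum.
  transitivity (\sum_i \sum_j \sum_(p <- S (i, j))
     torus_char p.2 h *: ((p.1 * c j) *: v i)); last first.
    by rewrite pair_big; apply: eq_bigr => -[i j] _; rewrite big_map.
  rewrite exchange_big /=.
  apply: eq_bigr => j _; rewrite actZ Mv scaler_sumr; apply: eq_bigr => i _.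
  rewrite (SP (i, j)) scaler_suml scaler_sumr; apply: eq_bigr => p _ /=.
  by rewrite !scalerA; congr (_ *: _); ring.
pose s := undup [seq p.1 | p <- l].
pose w0 m := \sum_(p <- l | p.1 == m) p.2.
have us : uniq s by exact: undup_uniq.
have acts h : act h a = \sum_(m <- s) torus_char m h *: w0 m.
  rewrite actl; under [RHS]eq_bigr do rewrite scaler_sumr big_mkcond.
  rewrite exchange_big /= big_seq [RHS]big_seq; apply: eq_bigr => p pl.
  rewrite (bigD1_seq p.1) ?mem_undup ?map_f //= eqxx big1 ?addr0 // => m.
  by rewrite eq_sym => /negPf ->.
have w0P m : m \in s -> has_degree act m (w0 m).
  move=> ms g; apply/eqP; rewrite -subr_eq0; apply/eqP.
  apply: (torus_char_independent charK0 (w := fun m => act g (w0 m) -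
    torus_char m g *: w0 m) us) => // h.
  have := acts (g * h)%g; rewrite (action_mul actP) acts act_sum => e.
  under eq_bigr do rewrite scalerBr; rewrite sumrB.
  apply/eqP; rewrite subr_eq0; apply/eqP.
  under eq_bigr do rewrite -actZ; rewrite e; apply: eq_bigr => k _.
  by rewrite torus_charM scalerA mulrC.
exists s, (fun m => if m \in s then w0 m else 0); split=> //.
  by move=> m; case: ifP => [/w0P//|_]; apply: has_degree0.
rewrite -[LHS](action_one actP) acts; rewrite big_seq [RHS]big_seq.
by apply: eq_bigr => m ->; rewrite torus_char1 scale1r.
Qed.

(** The eigenvalue of an eigenvector is a priori an arbitrary function on the
torus; it has to agree with the weight of any nonzero weight component. *)
Lemma eigenvector_has_degree a :
  is_eigenvector act a -> exists m, has_degree act m a.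
Proof.
case=> a0 [chi achi]; have [s [w [us dw aE]]] := weight_decomposition a.
have [m [ms wm0]] : exists m, m \in s /\ w m != 0.
  apply: contrapT => H; case/eqP: a0; rewrite aE big_seq big1 // => m ms.
  by apply/eqP; apply: contra_notT H => ?; exists m.
exists m => h; rewrite achi; congr (_ *: _); apply/eqP.
have := torus_char_independent charK0 (w := fun m => (torus_char m h - chi h)
  *: w m) us _ ms.
move=> /(_ _)/eqP; rewrite scaler_eq0 (negPf wm0) orbF subr_eq0 eq_sym;
  apply=> g.
have := achi h; rewrite {1}aE act_sum => /(congr1 (act g)).
rewrite actZ {1}aE !act_sum scaler_sumr => /eqP;
  rewrite -subr_eq0 -sumrB => /eqP e.
rewrite -[RHS]e; apply: eq_bigr => k _.
rewrite -(action_mul actP) !dw torus_charM !scalerA -scalerBl; congr (_ *: _);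
  ring.
Qed.

Lemma additive_eq_homogeneous (V : zmodType) (f g : A -> V) :
  {morph f : a b / a + b} -> {morph g : a b / a + b} ->
  (forall m a, has_degree act m a -> f a = g a) -> f =1 g.
Proof.
move=> fD gD fg a; have [s [w [_ dw ->]]] := weight_decomposition a.
have f0 : f 0 = 0 by apply: (addrI (f 0)); rewrite -fD !addr0.
have g0 : g 0 = 0 by apply: (addrI (g 0)); rewrite -gD !addr0.
by rewrite (big_morph f fD f0) (big_morph g gD g0); apply: eq_bigr => m _;
  apply: fg.
Qed.

End Weights.

(** * Products of Poisson-primes in a noetherian H-Poisson-UFD *)

Section Ideals.
Variable A : comNzRingType.
Implicit Types I J : A -> Prop.

Definition ideal_add I J : A -> Prop := fun a =>
  exists x y, [/\ I x, J y & a = x + y].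

Lemma ideal_mulr I a b : is_ideal I -> I a -> I (a * b).
Proof. by case=> _ _ IM Ia; rewrite mulrC; apply: IM. Qed.

Lemma ideal_opp I a : is_ideal I -> I a -> I (- a).
Proof. by case=> _ _ IM Ia; rewrite -mulN1r; apply: IM. Qed.

Lemma ideal_sub I a b : is_ideal I -> I a -> I b -> I (a - b).
Proof.
by move=> II Ia Ib; case: (II) => _ ID _; apply: ID => //; apply: ideal_opp.
Qed.

Lemma principal_ideal (c : A) : is_ideal (principal c).
Proof.
split; first by exists 0; rewrite mul0r.
  by move=> _ _ [q ->] [q' ->]; exists (q + q'); rewrite mulrDl.
by move=> a _ [q ->]; exists (a * q); rewrite mulrA.
Qed.

Lemma ideal_add_ideal I J : is_ideal I -> is_ideal J ->
  is_ideal (ideal_add I J).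
Proof.
move=> [I0 ID IM] [J0 JD JM]; split.
- by exists 0, 0; rewrite addr0.
- move=> _ _ [x [y [Ix Jy ->]]] [x' [y' [Ix' Jy' ->]]].
  by exists (x + x'), (y + y'); split;
    [exact: ID | exact: JD | rewrite addrACA].
- move=> a _ [x [y [Ix Jy ->]]].
  by exists (a * x), (a * y); split; [exact: IM | exact: JM | rewrite mulrDr].
Qed.

Lemma ideal_addl I J a : is_ideal J -> I a -> ideal_add I J a.
Proof. by case=> J0 _ _ Ia; exists a, 0; rewrite addr0. Qed.

Lemma ideal_addr I J a : is_ideal I -> J a -> ideal_add I J a.
Proof. by case=> I0 _ _ Ja; exists 0, a; rewrite add0r. Qed.

(** Otherwise dependent choice would produce a strictly increasing chain of
bad ideals. *)
Lemma noetherian_ind (bad : (A -> Prop) -> Prop) :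
  noetherian A -> (forall I, bad I -> is_ideal I) ->
  (forall I, bad I ->
     exists J, [/\ bad J, subideal I J & exists2 a, J a & ~ I a]) ->
  forall I, ~ bad I.
Proof.
move=> noethA badI badS I0 bad0.
have [next nextP] := choice (fun I : {I | bad I} => badS (sval I) (svalP I)).
pose step x := exist bad (next x) (let: And3 badJ _ _ := nextP x in badJ).
pose chain n := iter n step (exist bad I0 bad0).
have [N NP] : exists N, forall n, (N <= n)%N ->
    subideal (sval (chain n)) (sval (chain N)).
  apply: noethA => n; first exact/badI/svalP.
  by have [] := nextP (chain n).
have [_ _ [a Ja]] := nextP (chain N); apply.
exact: (NP N.+1 (leqnSn N) a Ja).
Qed.

End Ideals.

Lemma associate_sym (A : idomainType) (a b : A) :
  associate a b -> associate b a.
Proof. by case=> w wU ->; exists w^-1; rewrite ?unitrV ?mulKr. Qed.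

Lemma prime_divisor_associate (A : idomainType) (a b : A) :
  ~ principal a 1 -> b != 0 -> quotient_is_domain (principal b) ->
  principal a b -> associate b a.
Proof.
move=> a1 b0 [_ bprime] [q bE]; have [] := bprime q a; first by exists 1;
  rewrite mul1r.
  case=> w qE; case: a1; exists w; apply: (mulfI b0).
  by rewrite mulr1 {1}bE qE; ring.
case=> w aE; exists q => //; apply/unitrPr; exists w.
by apply: (mulIf b0); rewrite mul1r -mulrA -aE -bE.
Qed.

Section PoissonIdeals.
Variables (K : fieldType) (r : nat) (B : idomainAlgType K).
Variables (br : B -> B -> B) (act : torus K r -> B -> B).
Hypothesis brP : is_poisson_bracket br.
Hypothesis actP : is_poisson_action br act.
Implicit Types I J : B -> Prop.

Lemma stable_poisson_ideal_add I J :
  is_stable_poisson_ideal br act I -> is_stable_poisson_ideal br act J ->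
  is_stable_poisson_ideal br act (ideal_add I J).
Proof.
move=> [[II Ibr] Iact] [[JI Jbr] Jact]; split; [split|].
- exact: ideal_add_ideal.
- move=> a _ [x [y [Ix Jy ->]]]; rewrite (derD (poisson_deriv_r brP a)).
  by exists (br a x), (br a y); split; [exact: Ibr | exact: Jbr |].
- move=> h _ [x [y [Ix Jy ->]]]; rewrite (actD actP).
  by exists (act h x), (act h y); split; [exact: Iact | exact: Jact |].
Qed.

Lemma br_antisym a b : br a b = - br b a.
Proof.
have := poisson_alt brP (a + b).
rewrite (derD (poisson_deriv_l brP _)) !(derD (poisson_deriv_r brP _)).
rewrite !(poisson_alt brP) add0r addr0 => /eqP; rewrite addr_eq0 => /eqP //.
Qed.

Lemma normal_eigenvector_ideal c : is_eigenvector act c ->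
  (forall a, principal c (br c a)) ->
  is_stable_poisson_ideal br act (principal c).
Proof.
move=> [_ [chi actc]] cN; split; [split; first exact: principal_ideal|].
  move=> a _ [q ->]; rewrite (derM (poisson_deriv_r brP _)).
  have [z caE] := cN a; exists (br a q - q * z).
  by rewrite (br_antisym a c) caE; ring.
move=> h _ [q ->]; exists (chi h *: act h q).
by rewrite (actM actP) actc -scalerAl -scalerAr.
Qed.

Hypotheses (noethB : noetherian B) (ufdB : is_H_poisson_UFD br act).

(** Noetherian induction. An ideal [J] that is not H-Poisson-prime contains
[I1 I2] for some [I1], [I2] not contained in [J]; products of Poisson-primes
found in [J + I1] and in [J + I2] multiply to one in [J]. *)
Lemma stable_poisson_ideal_contains_prime_product J :
  is_stable_poisson_ideal br act J -> (exists2 a, J a & a != 0) ->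
  exists s : seq B,
    (forall c, c \in s -> homogeneous_poisson_prime br act c) /\
    J (\prod_(c <- s) c).
Proof.
pose good J := exists s : seq B,
  (forall c, c \in s -> homogeneous_poisson_prime br act c) /\
  J (\prod_(c <- s) c).
pose bad J := [/\ is_stable_poisson_ideal br act J, exists2 a, J a & a != 0
                & ~ good J].
move=> JP Jn0; apply: contrapT => Jbad.
apply: (noetherian_ind (bad := bad) noethB) (J) _ => //;
  first by move=> I [[[]]].
move=> {JP Jn0 Jbad}J [JP Jn0 Jbad]; have [[JI Jbr] Jact] := JP.
have [_ _ ufd] := ufdB.
have J1 : ~ J 1 by move=> J1; apply: Jbad; exists [::]; rewrite big_nil.
apply: contrapT => Jmax; apply: Jbad.
have goodadd I : is_stable_poisson_ideal br act I -> ~ subideal I J ->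
    good (ideal_add J I).
  move=> IP IJ; apply: contrapT => badJI; apply: Jmax.
  exists (ideal_add J I); split.
  - split=> //; first exact: stable_poisson_ideal_add.
    by have [a Ja a0] := Jn0; exists a => //; apply: ideal_addl => //;
      case: IP => [[]].
  - by move=> a; apply: ideal_addl; case: IP => [[]].
  - apply: contrapT => H; apply: IJ => a Ia; apply: contrapT => Ja; apply: H.
    by exists a => //; apply: ideal_addr.
have [Jprime|] := pselect (is_H_poisson_prime_ideal br act J).
  have [c [Jc cprime ceig]] := ufd J Jprime Jn0.
  exists [:: c]; rewrite big_seq1; split=> // _ /predU1P[->|//].
  by split=> //; right.
move=> notprime; have : exists I1 I2, [/\ is_stable_poisson_ideal br act I1,
    is_stable_poisson_ideal br act I2, subideal (ideal_mul I1 I2) J,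
    ~ subideal I1 J & ~ subideal I2 J].
  apply: contrapT => H; apply: notprime; split=> // I1 I2 I1P I2P I12.
  by apply: contrapT => /not_orP[n1 n2]; apply: H; exists I1, I2.
move=> [I1 [I2 [I1P I2P I12 /(goodadd _ I1P) [s1 [s1P Js1]] /(goodadd _ I2P)
  [s2 [s2P Js2]]]]].
exists (s1 ++ s2); split; first by move=> c; rewrite mem_cat => /orP[/s1P|/s2P].
rewrite big_cat /=; have [x1 [y1 [Jx1 Iy1 ->]]] := Js1.
have [x2 [y2 [Jx2 Iy2 ->]]] := Js2; have [_ JD JM] := JI.
rewrite mulrDl; apply: (JD); first exact: ideal_mulr.
rewrite mulrDr; apply: JD; first exact: JM.
by apply: I12; exists 1%N, (fun=> y1), (fun=> y2); rewrite big_ord1.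
Qed.

End PoissonIdeals.

(** * Prime elements of a polynomial ring *)

Section PolynomialPrimes.
Variable B : idomainType.
Implicit Types (f g q v : {poly B}) (u c s : B).

Lemma principal_polyC c f :
  (forall k, principal c f`_k) <-> principal c%:P f.
Proof.
split; last by case=> q -> k; rewrite coefMC; exists q`_k.
elim/poly_ind: f => [_|f a IH fk]; first by exists 0; rewrite mul0r.
have [q ->] : principal c%:P f.
  by apply: IH => k; have := fk k.+1; rewrite coefD coefMX coefC addr0.
have := fk 0%N; rewrite coefD coefMX coefC add0r /= => -[w ->].
by exists (q * 'X + w%:P); rewrite polyCM; ring.
Qed.

(** Gauss's lemma by removal of constant terms: [c] divides the product of the
constant terms of the two factors, hence one of them, and that term can be
dropped from its factor. *)
Lemma quotient_is_domain_polyC c :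
  quotient_is_domain (principal c) -> quotient_is_domain (principal c%:P).
Proof.
case=> c1 cprime; split.
  by case/principal_polyC/(_ 0%N) => q; rewrite coefC /= => e; apply: c1;
    exists q.
have cX f : principal c%:P (f * 'X) -> principal c%:P f.
  move=> fX; apply/principal_polyC => k; move/principal_polyC/(_ k.+1): fX.
  by rewrite coefMX.
have cMXaddC f a : principal c a -> principal c%:P f ->
    principal c%:P (f * 'X + a%:P).
  move=> [w ->] [q ->]; exists (q * 'X + w%:P); rewrite polyCM; ring.
have cancel x y : principal c%:P (x + y) -> principal c%:P y ->
  principal c%:P x.
  by move=> cxy cy; rewrite -(addrK y x); apply: ideal_sub => //;
    exact: principal_ideal.
elim/poly_ind => [|f a IHf]; first by left; exists 0; rewrite mul0r.
elim/poly_ind => [|g b IHg]; first by right; exists 0; rewrite mul0r.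
move=> cfg; have [ca|cb] : principal c a \/ principal c b.
- apply: cprime; move/principal_polyC/(_ 0%N): cfg.
  by rewrite coefM big_ord1 /= !coefD !coefMX !coefC !add0r.
- have [|cf|cg] := IHf (g * 'X + b%:P); [|by left; exact: cMXaddC|by right].
  apply: cX; apply: (cancel _ (a%:P * (g * 'X + b%:P))).
    by move: cfg; rewrite mulrDl mulrAC.
  by case: ca => w ->; exists (w%:P * (g * 'X + b%:P)); rewrite polyCM; ring.
- have [|cf|cg] := IHg; [|by left|by right; exact: cMXaddC].
  apply: cX; apply: (cancel _ ((f * 'X + a%:P) * b%:P)).
    by move: cfg; rewrite mulrDr mulrA.
  by case: cb => w ->; exists ((f * 'X + a%:P) * w%:P); rewrite polyCM; ring.
Qed.

Lemma size_linear u c : u != 0 -> size (u%:P * 'X - c%:P) = 2.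
Proof.
by move=> u0; rewrite -polyCN size_MXaddC polyC_eq0 (negPf u0) size_polyC u0.
Qed.

Lemma principal_size v f : f != 0 -> principal v f -> (size v <= size f)%N.
Proof.
move=> + [q fE]; rewrite fE mulf_eq0 negb_or => /andP[q0 v0].
rewrite size_mul //; rewrite -size_poly_gt0 in q0.
by rewrite -(ltn_predK q0) addSn leq_addl.
Qed.

Lemma principal_linear_polyC u c s :
  u != 0 -> principal (u%:P * 'X - c%:P) s%:P -> s = 0.
Proof.
move=> u0 vs; apply/eqP; apply: contraT => s0.
have := principal_size _ vs; rewrite polyC_eq0 size_linear // size_polyC s0.
by move=> /(_ isT).
Qed.

Lemma linear_pseudo_division u c f : u != 0 ->
  exists N q s, (u ^+ N)%:P * f = q * (u%:P * 'X - c%:P) + s%:P.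
Proof.
move=> u0; set v := _ - _; have sv := size_linear c u0.
have lv : lead_coef v = u.
  by rewrite lead_coefE sv coefB coefMX !coefC subr0.
exists (scalp f v), (f %/ v), (f %% v)`_0.
rewrite mul_polyC -lv Pdiv.Idomain.divp_eq; congr (_ + _); apply: size1_polyC.
by have := ltn_modpN0 f (_ : v != 0); rewrite -size_poly_gt0 sv => /(_ isT).
Qed.

(** The prime [u] of [B[x]] divides [q v] but not [v], so it cancels from
[u f = q v]. *)
Lemma linear_saturated u c (v := u%:P * 'X - c%:P) :
  quotient_is_domain (principal u) -> u != 0 -> ~ principal u c ->
  forall f, principal v (u%:P * f) -> principal v f.
Proof.
move=> /quotient_is_domain_polyC[_ uprime] u0 uc f [q e].
have [[q' qE]|/principal_polyC/(_ 0%N)] : principal u%:P q \/ principal u%:P v.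
- by apply: uprime; exists f; rewrite -e mulrC.
- exists q'; apply: (@mulfI _ u%:P); rewrite ?polyC_eq0 // e qE; ring.
- rewrite coefB coefMX !coefC sub0r => /= uNc; case: uc.
  by rewrite -(opprK c); apply: (ideal_opp (principal_ideal u)).
Qed.

(** Up to powers of [u], which saturation removes, the remainder of division by
[u x - c] is the value at [c / u], and values in a domain multiply. *)
Lemma quotient_is_domain_linear u c (v := u%:P * 'X - c%:P) : u != 0 ->
  (forall f, principal v (u%:P * f) -> principal v f) ->
  quotient_is_domain (principal v).
Proof.
move=> u0 vsat; have vsatX N f : principal v ((u ^+ N)%:P * f) -> principal v f.
  elim: N => [|N IH]; first by rewrite expr0 mul1r.
  by rewrite exprS polyCM -mulrA => /vsat.
split=> [|f g vfg]; first by move/(principal_linear_polyC u0)/eqP;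
  rewrite oner_eq0.
have [N [q [s fE]]] := linear_pseudo_division c f u0.
have [M [p [t gE]]] := linear_pseudo_division c g u0; rewrite -/v in fE gE.
have : s * t = 0.
  apply: (principal_linear_polyC (c := c) u0); rewrite -/v polyCM.
  have -> : s%:P * t%:P = (u ^+ N)%:P * (u ^+ M)%:P * (f * g)
      - (q * p * v + q * t%:P + p * s%:P) * v.
    have -> : (u ^+ N)%:P * (u ^+ M)%:P * (f * g)
      = ((u ^+ N)%:P * f) * ((u ^+ M)%:P * g) by ring.
    by rewrite fE gE; ring.
  have [_ _ vM] := principal_ideal v.
  by apply: ideal_sub; [exact: principal_ideal | exact: vM | apply: vM;
    exists 1; rewrite mul1r].
move/eqP; rewrite mulf_eq0 => /orP[] /eqP e0.
  by left; apply: (vsatX N); exists q; rewrite fE e0 addr0.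
by right; apply: (vsatX M); exists p; rewrite gE e0 addr0.
Qed.

End PolynomialPrimes.

(** * Brackets in a Poisson-Ore extension *)

Section PoissonOre.
Variables (K : fieldType) (B : idomainAlgType K).
Variables (brB : B -> B -> B) (sigma delta : B -> B).
Variable brR : polyAlg B -> polyAlg B -> polyAlg B.
Hypothesis oreP : is_poisson_ore brB sigma delta brR.
Implicit Types (f g v : {poly B}) (a b c u : B).

Lemma oreDl f g v : brR (f + g) v = brR f v + brR g v :> {poly B}.
Proof. exact: derD (poisson_deriv_l (ore_bracketR oreP) v) f g. Qed.

Lemma oreDr f g v : brR v (f + g) = brR v f + brR v g :> {poly B}.
Proof. exact: derD (poisson_deriv_r (ore_bracketR oreP) v) f g. Qed.

Lemma oreBl f g v : brR (f - g) v = brR f v - brR g v :> {poly B}.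
Proof. exact: derB (poisson_deriv_l (ore_bracketR oreP) v) f g. Qed.

Lemma oreMl f g v : brR (f * g) v = brR f v * g + f * brR g v :> {poly B}.
Proof. exact: derM (poisson_deriv_l (ore_bracketR oreP) v) f g. Qed.

Lemma oreMr f g v : brR v (f * g) = brR v f * g + f * brR v g :> {poly B}.
Proof. exact: derM (poisson_deriv_r (ore_bracketR oreP) v) f g. Qed.

Lemma ore0l v : brR 0 v = 0 :> {poly B}.
Proof. exact: der0 (poisson_deriv_l (ore_bracketR oreP) v). Qed.

Lemma ore0r v : brR v 0 = 0 :> {poly B}.
Proof. exact: der0 (poisson_deriv_r (ore_bracketR oreP) v). Qed.

Lemma oreC a b : brR a%:P b%:P = (brB a b)%:P :> {poly B}.
Proof. exact: ore_extends oreP a b. Qed.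

Lemma oreXC b : brR 'X b%:P = (sigma b)%:P * 'X + (delta b)%:P :> {poly B}.
Proof. exact: ore_X oreP b. Qed.

Lemma oreXX : brR 'X 'X = 0 :> {poly B}.
Proof. exact: poisson_alt (ore_bracketR oreP) _. Qed.

Lemma ore_antisym f g : brR f g = - brR g f :> {poly B}.
Proof.
have := poisson_alt (ore_bracketR oreP) (f + g).
have -> := oreDl f g (f + g); rewrite !oreDr.
have -> : brR f f = 0 := poisson_alt (ore_bracketR oreP) f.
have -> : brR g g = 0 := poisson_alt (ore_bracketR oreP) g.
rewrite add0r addr0 => e; apply/eqP; rewrite -addr_eq0; exact/eqP.
Qed.

Lemma coef_oreC f b k : (brR f b%:P : {poly B})`_k =
  brB f`_k b + sigma b * f`_k *+ k + delta b * f`_k.+1 *+ k.+1.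
Proof.
have brB0 : brB 0 b = 0 by exact: der0 (poisson_deriv_l (ore_bracketB oreP) b).
elim/poly_ind: f k => [k|f a IH k]; first by rewrite ore0l !coef0 brB0 !mulr0
  !mul0rn !addr0.
rewrite oreDl oreMl oreC oreXC mulrDr mulrA !coefD !coefMX !coefMC coefC.
case: k => [|k] /=; first by rewrite !coefC /= mulr0n mulr1n !add0r !addr0
  addrC mulrC.
by rewrite IH !coefC /= !addr0 !mulrS; ring.
Qed.

Lemma size_oreC f b : (size (brR f b%:P : {poly B}) <= size f)%N.
Proof.
apply/leq_sizeP => k fk; rewrite coef_oreC !nth_default ?(leq_trans fk) //.
by rewrite (der0 (poisson_deriv_l (ore_bracketB oreP) b)) !mulr0 !mul0rn !addr0.
Qed.

(** Bracketing with [v] is a derivation, and [B[x]] is generated by [x] and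
[B]. *)
Lemma ore_normal v : principal v (brR v 'X) ->
  (forall b, principal v (brR v b%:P)) -> forall f, principal v (brR v f).
Proof.
move=> vX vC; have [v0 vD vM] := principal_ideal v.
elim/poly_ind => [|f b IH]; first by rewrite ore0r.
by rewrite oreDr oreMr; apply: (vD) => //; apply: vD; [rewrite mulrC|];
  apply: vM.
Qed.

(** Bracketing with an element of [B] does not raise the degree in [x], so the
multiplier has degree 0. *)
Lemma ore_normal_scalar f b : principal f (brR f b%:P) ->
  exists z, brR f b%:P = z%:P * f :> {poly B}.
Proof.
case=> q e; have [f0|f0] := eqVneq f 0.
  by exists 0; rewrite f0 ore0l mulr0.
have q1 : (size q <= 1)%N.
  have [->|q0] := eqVneq q 0; first by rewrite size_poly0.
  have := size_oreC f b; rewrite e size_mul //.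
  rewrite -size_poly_gt0 in f0; rewrite -(prednK f0) addnS /=.
  by rewrite -add1n leq_add2r.
by exists q`_0; rewrite e {1}(size1_polyC q1).
Qed.

Lemma ore_prime_polyC c : poisson_prime brB c ->
  principal c (sigma c) -> principal c (delta c) ->
  poisson_prime brR (polyAlgC c).
Proof.
case=> c0 cN cdom cs cd; split.
- by rewrite /polyAlgC polyC_eq0.
- apply: ore_normal => [|b].
    rewrite ore_antisym oreXC; case: cs cd => [s ->] [d ->].
    by exists (- (s%:P * 'X + d%:P)); rewrite !polyCM; ring.
  by rewrite oreC; have [q ->] := cN b; exists q%:P; rewrite polyCM.
- exact: quotient_is_domain_polyC.
Qed.

Lemma ore_prime_polyC_inv c : poisson_prime brR (polyAlgC c) ->
  poisson_prime brB c /\ principal c (delta c).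
Proof.
have dvdC a : principal c%:P a%:P -> principal c a.
  by move/principal_polyC/(_ 0%N); rewrite coefC.
case=> c0 cN [c1 cdom]; split; [split|].
- by rewrite -polyC_eq0.
- by move=> a; apply: dvdC; rewrite -oreC; apply: cN.
- split=> [[q e]|a b [q e]].
    by apply: c1; exists q%:P; have := congr1 polyC e; rewrite polyCM.
  have [|/dvdC|/dvdC] := cdom a%:P b%:P; [|by left|by right].
  by exists q%:P; have := congr1 polyC e; rewrite !polyCM.
- have /principal_polyC/(_ 0%N) := cN 'X.
  rewrite ore_antisym oreXC coefN coefD coefMX !coefC /= add0r => cNd.
  by rewrite -(opprK (delta c)); apply: (ideal_opp (principal_ideal c)).
Qed.

End PoissonOre.

(** * Poisson-primes of B that do not divide their image under delta *)

Section KeyIdentity.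
Variables (K : fieldType) (B : idomainAlgType K).
Variables (br : B -> B -> B) (sigma delta : B -> B) (lam : K).
Hypotheses (charK0 : [pchar K] =i pred0) (brP : is_poisson_bracket br).
Hypotheses (sigmaP : is_derivation sigma).
Hypotheses (deltaP : is_poisson_sderivation br sigma delta).
Hypotheses (nild : locally_nilpotent delta) (lam_neq0 : lam != 0).
Hypothesis sigma_delta :
  forall b, sigma (delta b) = delta (sigma b) + lam *: delta b.

Let derd := deltaP.1.

Variables (u : B) (D : B -> B) (mu : K) (n : nat).
Hypothesis u_normal : forall b, br u b = D b * u.
Hypothesis sigma_u : sigma u = mu *: u.
Hypotheses (u_height : iter n delta u != 0) (u_heightS : iter n.+1 delta u = 0).

Let d j := iter j delta u.
Let L : B := lam%:A.

(** Up to the factor [(- L)^j j!], this is the coefficient of [x^(n - j)] in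
[{p, b} - (D b + n sigma b) p], where
[p = sum_j (- 1 / L)^j / j! delta^j(u) x^(n - j)]. *)
Let defect j b := br (d j) b - (D b + j%:R * sigma b) * d j
             - L * (j%:R * (n.+1%:R - j%:R)) * d j.-1 * delta b.

(** Twisted commutator of [delta] and [D]: the error term in the recursion that
[delta] induces on the defects. *)
Let obstruction b := D (delta b) - delta (D b) + (mu%:A + n%:R * L) * delta b.

Lemma sigma_iter_delta j : sigma (d j) = (mu + lam *+ j) *: d j.
Proof.
elim: j => [|j IH]; first by rewrite mulr0n addr0.
rewrite /d iterS sigma_delta -/(d j) IH (derZ derd) -scalerDl mulrSr addrA //.
Qed.

Lemma delta_natr k : delta k%:R = 0.
Proof. by rewrite (derMn derd) (der1 derd) mul0rn. Qed.

Lemma defect_rec j b :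
  delta (defect j b) - defect j.+1 b
  = obstruction b * d j + defect j (delta b).
Proof.
have dL : delta L = 0 by exact: der_alg derd lam.
have dk := delta_natr.
have dbr : delta (br (d j) b) = br (d j.+1) b + br (d j) (delta b)
    + (mu%:A + j%:R * L) * d j * delta b - d j.+1 * sigma b.
  rewrite deltaP.2 sigma_iter_delta -[in LHS]mulr_algl;
    congr (_ + _ * _ * _ - _).
  by rewrite scalerDl -scalerMnl mulr_natl.
have dj : j%:R * delta (d j.-1) = j%:R * d j by case: (j) => // ;
  rewrite !mul0r.
have dterm : delta (L * (j%:R * (n.+1%:R - j%:R)) * d j.-1 * delta b)
    = L * (j%:R * (n.+1%:R - j%:R)) * (d j * delta b + d j.-1 * delta
      (delta b)).
  rewrite -[in LHS]mulrA (derM derd (L * _)) !(derM derd L) (derM derd j%:R)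
    (derB derd) !dk dL.
  rewrite (derM derd).
  transitivity (L * (n.+1%:R - j%:R) * (j%:R * delta (d j.-1) * delta b
    + j%:R * d j.-1 * delta (delta b))); first by ring.
  by rewrite dj; ring.
rewrite /defect !(derB derd) dbr dterm (derM derd (_ + _)) (derD derd)
  (derM derd j%:R) dk.
have sd : delta (sigma b) = sigma (delta b) - L * delta b.
  by rewrite sigma_delta mulr_algl addrK.
rewrite sd -/(d j.+1) /obstruction -[delta (d j)]/(d j.+1) /=.
ring.
Qed.

(** By induction on the nilpotency index of [b], the defects of [delta b]
vanish, so [delta (defect j b) - defect j.+1 b = obstruction b * d j]. Hence
[defect n b * d j - d n * defect j b] is [delta^j (defect n b * u)]. It is 0 for
[j = n], while [delta^n u <> 0]; additivity of heights forces
[defect n b = 0]. Then [obstruction b * d n = 0], the obstruction vanishes, and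
the recursion propagates [defect 0 b = 0]. *)
Lemma defect_eq0 m b : iter m delta b = 0 -> forall j, defect j b = 0.
Proof.
have u0 : u != 0 by apply: contraNneq u_height => ->; rewrite (der_iter0 derd).
elim: m b => [b /= ->|m IH b].
  have D0 : D 0 = 0.
    apply: (mulIf u0); rewrite -u_normal mul0r;
      exact: der0 (poisson_deriv_r brP u).
  move=> j; rewrite /defect (der0 (poisson_deriv_r brP _)) D0 (der0 sigmaP)
    (der0 derd); ring.
rewrite iterSr => /IH Gdb; have rec j : delta (defect j b) - defect j.+1 b
  = obstruction b * d j.
  by rewrite defect_rec Gdb addr0.
have G0 : defect 0 b = 0 by rewrite /defect /= u_normal; ring.
have GnS : defect n.+1 b = 0.
  rewrite /defect -/(d n.+1) [d n.+1]u_heightS (der0 (poisson_deriv_l brP _));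
    ring.
have dGn : delta (defect n b) = obstruction b * d n by rewrite -rec GnS subr0.
have wE j : iter j delta (defect n b * u) = defect n b * d j - d n * defect j b.
  elim: j => [|j IHj]; first by rewrite G0 mulr0 subr0.
  rewrite iterS IHj (derB derd) !(derM derd) dGn -/(d n.+1)
    -[delta (d n)]/(d n.+1).
  rewrite [d n.+1]u_heightS -[delta (d j)]/(d j.+1).
  have -> : delta (defect j b) = obstruction b * d j + defect j.+1 b by
    rewrite -rec subrK.
  ring.
have Gn0 : defect n b = 0.
  apply/eqP; apply: contraT => Gn0; have [k [Gk GkS]] := lnd_height nild Gn0.
  have := lnd_height_mul charK0 derd Gk GkS u_height u_heightS.
  by rewrite iterD wE mulrC subrr (der_iter0 derd) eqxx.
have E0 : obstruction b = 0.
  apply: (mulIf u_height); rewrite mul0r; have := dGn; rewrite Gn0 (der0 derd).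
  by move=> <-.
elim=> [//|j IHj]; have := rec j; rewrite IHj (der0 derd) E0 mul0r sub0r.
by move/eqP; rewrite oppr_eq0 => /eqP.
Qed.

(** This is the vanishing of [defect 1 b]. *)
Lemma delta_via_bracket b :
  lam *: (u * delta b) *+ n = br (delta u) b - (D b + sigma b) * delta u.
Proof.
have [m dm] := nild b; have := defect_eq0 dm 1; rewrite /defect /d /= => e.
by rewrite -[RHS]subr0 -e -mulr_algl -/L -mulr_natl; ring.
Qed.

Hypothesis u_prime : quotient_is_domain (principal u).
Hypothesis u_ndvd : ~ principal u (delta u).

(** At [b = u] the previous identity determines [D (delta u)]; at [b = delta u]
it then becomes [n u delta^2(u) = (n - 1) (delta u)^2], so [u] would divide
[delta u] if [n] were not 1. *)
Lemma height_eq1 : n = 1%N.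
Proof.
have u0 : u != 0 by apply: contraNneq u_height => ->; rewrite (der_iter0 derd).
have nL b : lam *: (u * b) *+ n = n%:R * L * (u * b).
  by rewrite -mulr_algl -/L -[LHS]mulr_natl mulrA.
have Duu : D u = 0.
  by apply: (mulIf u0); rewrite -u_normal (poisson_alt brP) mul0r.
have Ddu : D (delta u) = - (mu%:A + n%:R * L) * delta u.
  apply: (mulIf u0); have := delta_via_bracket u.
  rewrite nL (br_antisym brP) u_normal Duu sigma_u add0r -[mu *: u]mulr_algl
    => e.
  transitivity (- (- (D (delta u) * u) - mu%:A * u * delta u) - mu%:A * u *
    delta u).
    by ring.
  by rewrite -e; ring.
have n0 : (0 < n)%N.
  rewrite lt0n; apply: contra_notN u_ndvd => /eqP n0.
  by exists 0; move: u_heightS; rewrite n0 mul0r.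
have n1E : n%:R = n.-1%:R + 1 :> B by rewrite -[in LHS](prednK n0) mulrSr.
have dvd2 : principal u ((lam *+ n.-1) *: (delta u * delta u)).
  have sdu : sigma (delta u) = (mu%:A + L) * delta u.
    by rewrite [LHS](sigma_iter_delta 1) mulr1n -[LHS]mulr_algl scalerDl.
  exists (n%:R * L * delta (delta u)); have := delta_via_bracket (delta u).
  rewrite nL (poisson_alt brP) Ddu sdu n1E => e.
  rewrite -mulr_algl -scalerMnl -/L -[L *+ _]mulr_natl.
  transitivity (0 - (- (mu%:A + (n.-1%:R + 1) * L) * delta u + (mu%:A + L) *
    delta u) * delta u).
    by ring.
  by rewrite -e; ring.
apply/eqP; rewrite -(prednK n0) eqSS; apply: contra_notT u_ndvd => n1.
suff dvd : principal u (delta u * delta u) by case: (u_prime.2 _ _ dvd).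
have k0 : lam *+ n.-1 != 0.
  by rewrite -mulr_natl mulf_neq0 // ((pcharf0P K).1 charK0).
case: dvd2 => q e; exists ((lam *+ n.-1)^-1 *: q).
by rewrite -scalerAl -e scalerA mulVf // scale1r.
Qed.

(** The numerator of the fraction [c / u] for which [x - c / u] is
Poisson-normal once [u] is inverted. *)
Definition shift_num : B := lam^-1 *: delta u.

Lemma delta_eq_shift_num : delta u = lam *: shift_num.
Proof. by rewrite scalerA mulfV // scale1r. Qed.

Lemma delta_shift_num : delta shift_num = 0.
Proof.
by rewrite (derZ derd) -[delta _]/(iter 2 delta u) -height_eq1 u_heightS scaler0.
Qed.

Lemma bracket_shift_num b :
  br shift_num b = u * delta b + (D b + sigma b) * shift_num.
Proof.
rewrite /shift_num (derZ (poisson_deriv_l brP b)) -scalerAr.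
have := delta_via_bracket b; rewrite height_eq1 mulr1n.
move/(congr1 ( *:%R lam^-1)); rewrite scalerA mulVf // scale1r => ->.
by rewrite -scalerDr subrK.
Qed.

End KeyIdentity.

(** * Weights in a Poisson-Cauchon extension *)

(** The differential of the character [m], evaluated at [xi]. *)
Definition lie_weight (K : fieldType) r (xi : 'rV[K]_r) (m : 'rV[int]_r) : K :=
  \sum_i (m 0 i)%:~R * xi 0 i.

Lemma lie_weightD (K : fieldType) r (xi : 'rV[K]_r) m1 m2 :
  lie_weight xi (m1 + m2) = lie_weight xi m1 + lie_weight xi m2.
Proof.
rewrite /lie_weight -big_split; apply: eq_bigr => i _.
by rewrite mxE rmorphD mulrDl.
Qed.

Lemma lie_weightMn (K : fieldType) r (xi : 'rV[K]_r) m n :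
  lie_weight xi (m *+ n) = lie_weight xi m *+ n.
Proof.
elim: n => [|n IH]; last by rewrite !mulrS lie_weightD IH.
by rewrite mulr0n /lie_weight big1 // => i _; rewrite mxE mul0r.
Qed.

Section CauchonWeights.
Variables (K : fieldType) (r : nat) (B : idomainAlgType K).
Variables (brB : B -> B -> B) (sigma delta : B -> B).
Variable brR : polyAlg B -> polyAlg B -> polyAlg B.
Variables (actB : torus K r -> B -> B).
Variables (actR : torus K r -> polyAlg B -> polyAlg B).
Hypothesis charK0 : [pchar K] =i pred0.
Hypothesis cauP : is_poisson_cauchon brB sigma delta brR actB actR.
Hypothesis actBP : is_poisson_action brB actB.
Implicit Types (m : 'rV[int]_r) (h : torus K r) (f v p : {poly B}).

Let oreP := cauchon_ore cauP.
Let actRP := cauchon_action cauP.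

Lemma coef_scale_polyAlg (k : K) f i :
  ((k *: (f : polyAlg B)) : {poly B})`_i = k *: f`_i.
Proof. by rewrite -[LHS]/((k%:A%:P * f)`_i) coefCM mulr_algl. Qed.

Lemma scale_polyAlgE (k : K) f :
  (k *: (f : polyAlg B)) = k%:A%:P * f :> {poly B}.
Proof. by []. Qed.

Lemma polyAlgC_scale (k : K) (b : B) : polyAlgC (k *: b) = k *: polyAlgC b.
Proof. by rewrite -mulr_algl /polyAlgC polyCM. Qed.

Lemma has_degree_polyAlgC m (b : B) :
  has_degree actR m (polyAlgC b) <-> has_degree actB m b.
Proof.
split=> db h; last by rewrite (cauchon_stable cauP) db polyAlgC_scale.
by apply: polyC_inj; have := db h;
  rewrite (cauchon_stable cauP) -polyAlgC_scale.
Qed.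

Lemma cauchon_has_degree_X : exists chi, has_degree actR chi polyAlgX.
Proof.
exact: (eigenvector_has_degree charK0 actRP (cauchon_rational cauP)
  (cauchon_X cauP)).
Qed.

Lemma polyAlgC_eigenvector (b : B) :
  is_eigenvector actB b <-> is_eigenvector actR (polyAlgC b).
Proof.
split=> -[b0 [xi bxi]]; split.
- by rewrite /polyAlgC polyC_eq0.
- by exists xi => h; rewrite (cauchon_stable cauP) bxi polyAlgC_scale.
- by rewrite -polyC_eq0.
- exists xi => h; apply: polyC_inj; have := bxi h.
  by rewrite (cauchon_stable cauP) -polyAlgC_scale.
Qed.

Lemma eigenvector_has_degreeB (b : B) :
  is_eigenvector actB b -> exists m, has_degree actB m b.
Proof.
move/polyAlgC_eigenvector/(eigenvector_has_degree charK0 actRP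
  (cauchon_rational cauP)).
by case=> m /has_degree_polyAlgC; exists m.
Qed.

Variable chi : 'rV[int]_r.
Hypothesis chiX : has_degree actR chi polyAlgX.

Lemma coef_actR h f k :
  (actR h f : {poly B})`_k = torus_char chi h ^+ k *: actB h f`_k.
Proof.
elim/poly_ind: f k => [k|f a IH k].
  by rewrite [actR h 0](act0 actRP) !coef0 (act0 actBP) scaler0.
have -> : actR h (f * 'X + a%:P) = actR h f * (torus_char chi h)%:A%:P * 'X +
  (actB h a)%:P :> {poly B}.
  rewrite [LHS](actD actRP); congr (_ + _); last exact: cauchon_stable cauP h a.
  rewrite [LHS](actM actRP) -mulrA; congr (_ * _); exact: chiX.
rewrite !coefD !coefMX !coefMC !coefC; case: k => [|k] /=.
  by rewrite !add0r expr0 scale1r.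
by rewrite IH !addr0 mulrC mulr_algl scalerA exprS.
Qed.

Lemma has_degree_coef m f k :
  has_degree actR m f -> has_degree actB (m - chi *+ k) f`_k.
Proof.
move=> df h; have /(congr1 (fun g : {poly B} => g`_k)) := df h.
rewrite coef_actR coef_scale_polyAlg torus_charD torus_charN torus_charMn.
move/(congr1 ( *:%R (torus_char chi h ^- k))).
by rewrite !scalerA mulVf ?expf_neq0 ?torus_char_neq0 // scale1r mulrC.
Qed.

Lemma additive_eq_homogeneousB (V : zmodType) (F G : B -> V) :
  {morph F : a b / a + b} -> {morph G : a b / a + b} ->
  (forall m a, has_degree actB m a -> F a = G a) -> F =1 G.
Proof.
move=> FD GD FG b.
have := @additive_eq_homogeneous K r _ brR actR charK0 actRP
  (cauchon_rational cauP)
  V (fun f => F (f : {poly B})`_0) (fun f => G (f : {poly B})`_0).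
move=> /(_ _ _ _ b%:P); rewrite coefC /=; apply.
- by move=> f g; rewrite coefD FD.
- by move=> f g; rewrite coefD GD.
- by move=> m f /(has_degree_coef 0); apply: FG.
Qed.

Variables (h0 : 'rV[K]_r) (D : polyAlg B -> polyAlg B) (lam : K).
Hypotheses (DP : is_lie_action actR h0 D).
Hypothesis D_sigma : forall b, D (polyAlgC b) = polyAlgC (sigma b).
Hypothesis D_X : D polyAlgX = lam *: polyAlgX.
Hypothesis lam_neq0 : lam != 0.

Lemma sigma_degree m (b : B) :
  has_degree actB m b -> sigma b = lie_weight h0 m *: b.
Proof.
move=> /has_degree_polyAlgC/(DP.2) e; apply: polyC_inj.
by rewrite -/(polyAlgC (sigma b)) -D_sigma e -polyAlgC_scale.
Qed.

Lemma lie_weight_X : lie_weight h0 chi = lam.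
Proof.
have /(congr1 (fun g : {poly B} => g`_1)) := esym (DP.2 _ _ chiX).
rewrite D_X !coef_scale_polyAlg coefX /= => /eqP.
by rewrite -subr_eq0 -scalerBl scaler_eq0 oner_eq0 orbF subr_eq0 => /eqP.
Qed.

Lemma delta_degree m (b : B) :
  has_degree actB m b -> has_degree actB (chi + m) (delta b).
Proof.
move/has_degree_polyAlgC => db.
have := has_degree_coef 0 (has_degree_br actRP (ore_bracketR oreP) chiX db).
rewrite mulr0n subr0 [brR _ _](oreXC oreP) coefD coefMX !coefC add0r //.
Qed.

(** On weight vectors [sigma] is the scalar [lie_weight], and [delta] shifts the
weight by that of [x]. *)
Lemma sigma_delta_comm b : sigma (delta b) = delta (sigma b) + lam *: delta b.
Proof.
have ds := (ore_sigma oreP).1; have dd := (ore_delta oreP).1.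
move: b; apply: additive_eq_homogeneousB => [a b|a b|m b db].
- by rewrite !(derD dd) (derD ds).
- by rewrite (derD ds) !(derD dd) scalerDr addrACA.
- rewrite (sigma_degree db) (sigma_degree (delta_degree db)) (derZ dd).
  by rewrite lie_weightD lie_weight_X scalerDl addrC.
Qed.

(** Let [s <> 0]. The brackets [{E, E} = 0] and [{s, s} = 0] give [z E = 0] and
[z s = - n sigma s]. Computing [{s, E}] through the multipliers of [s] and
through those of [E] then yields [n sigma(s) E = n sigma(E) s], which is false
as [sigma] has different eigenvalues on [s] and [E]. *)
Lemma normal_pair_eq0 (E s : B) (z : B -> B) (e : K) (n : nat) :
  E != 0 -> lam *+ n != 0 ->
  (forall b, brB E b = z b * E) -> sigma E = e *: E ->
  (forall b, brB s b = (z b + n%:R * sigma b) * s) ->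
  sigma s = (e + lam *+ n) *: s -> s = 0.
Proof.
have brP := ore_bracketB oreP.
move=> E0 ln0 zE sE zs ss; apply/eqP; apply: contraT => s0.
have zE0 : z E = 0 by apply: (mulIf E0); rewrite -zE (poisson_alt brP) mul0r.
have zs0 : z s = - (n%:R * sigma s).
  apply/eqP; rewrite -addr_eq0; apply/eqP/(mulIf s0).
  by rewrite -zs (poisson_alt brP) mul0r.
have := zs E; rewrite (br_antisym brP) zE zs0 zE0 sE ss add0r mulNr opprK.
rewrite -[(e + _) *: s]mulr_algl -[e *: E]mulr_algl scalerDl => H.
have : (lam *+ n)%:A * (n%:R * (s * E)) == 0.
  apply/eqP; transitivity (n%:R * ((e%:A + (lam *+ n)%:A) * s) * E - n%:R *
    (e%:A * E) * s).
    by ring.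
  by rewrite H subrr.
have n0 : n%:R != 0 :> B.
  by apply: (alg_natr_neq0 B charK0); case: n ln0 {zs ss zs0 H} => //;
    rewrite eqxx.
by rewrite !mulf_eq0 scaler_eq0 oner_eq0 orbF (negPf ln0) (negPf n0)
  (negPf s0) (negPf E0).
Qed.

(** ** Poisson-primes of degree one *)

Section Linear.
Variables (u c : B) (zu : B -> B) (mu : 'rV[int]_r).
Hypotheses (u0 : u != 0) (u_normal : forall b, brB u b = zu b * u).
Hypothesis u_degree : has_degree actB mu u.
Hypothesis c_degree : has_degree actB (chi + mu) c.
Hypothesis bracket_c : forall b, brB c b = u * delta b + (zu b + sigma b) * c.
Hypothesis delta_u : delta u = lam *: c.
Hypothesis delta_c : delta c = 0.

(** With [u = 1] and [c = 0] this is [x]; with [u] a prime not dividing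
[delta u] and [c] its [shift_num] it is the new Poisson-prime. *)
Let v : {poly B} := u%:P * 'X - c%:P.

Lemma linear_bracketC b : brR v b%:P = (zu b + sigma b)%:P * v :> {poly B}.
Proof.
rewrite (oreBl oreP) (oreMl oreP) !(oreC oreP) (oreXC oreP) u_normal bracket_c
  /v.
by rewrite !polyCD !polyCM !polyCD; ring.
Qed.

Lemma linear_normal f : principal v (brR v f).
Proof.
apply: (ore_normal oreP) => [|b]; last by exists (zu b + sigma b)%:P;
  rewrite linear_bracketC.
exists ((- lie_weight h0 mu)%:A%:P * 'X).
rewrite (oreBl oreP) (oreMl oreP) (oreXX oreP) mulr0 addr0.
rewrite (ore_antisym oreP u%:P) (ore_antisym oreP c%:P) !(oreXC oreP).
rewrite delta_u delta_c (sigma_degree u_degree) (sigma_degree c_degree).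
rewrite lie_weightD lie_weight_X -[lam *: c]mulr_algl -[_ *: u]mulr_algl.
rewrite -[(lam + _) *: c]mulr_algl scalerDl scaleNr /v !polyCM !polyCN !polyCD
  polyC0.
ring.
Qed.

Lemma linear_degree : has_degree actR (chi + mu) v.
Proof.
move=> h; have -> : v = polyAlgC u * polyAlgX - polyAlgC c :> polyAlg B by [].
rewrite (act_sub actRP) (actM actRP) chiX.
have -> := (has_degree_polyAlgC mu u).2 u_degree h.
have -> := (has_degree_polyAlgC (chi + mu) c).2 c_degree h.
by rewrite scalerBr -scalerAl -scalerAr scalerA torus_charD mulrC.
Qed.

(** Modulo [v] the polynomial [f] becomes [s], so [s] has the weight of [f] and
satisfies [{s, b} = z b * s] with the multipliers [z] of [f]. The leading
coefficient of [f] has multipliers [z b - n.+1 * sigma b], so the two form a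
pair excluded by [normal_pair_eq0]. *)
Lemma linear_remainder_eq0 f q s n m :
  size f = n.+2 -> (forall b, principal f (brR f b%:P)) ->
  has_degree actR m f ->
  f = q * v + s%:P -> s = 0.
Proof.
move=> sf f_normal f_degree fE.
have [z zP] := choice (fun b => ore_normal_scalar oreP (f_normal b)).
have const_eq (a b : B) : principal v (a%:P - b%:P) -> a = b.
  by rewrite -polyCB => /(principal_linear_polyC u0)/eqP;
    rewrite subr_eq0 => /eqP.
have s_normal b : brB s b = z b * s.
  apply: const_eq; exists ((z b)%:P * q - brR q b%:P - q * (zu b + sigma b)%:P).
  have := zP b; rewrite {1}fE (oreDl oreP) (oreMl oreP) (oreC oreP)
    linear_bracketC fE.
  by rewrite polyCM => /(canRL (addKr _)) ->; ring.
have s_degree : has_degree actB m s.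
  move=> h; apply: const_eq.
  have := f_degree h;
    rewrite fE [actR h _](actD actRP) [actR h (q * v)](actM actRP).
  rewrite linear_degree !scale_polyAlgE [actR h s%:P](cauchon_stable cauP)
    /polyAlgC.
  move/(canRL (addKr _)) => e.
  exists ((torus_char m h)%:A%:P * q - actR h q * (torus_char (chi + mu)
    h)%:A%:P).
  rewrite -[torus_char m h *: s]mulr_algl polyCM.
  by rewrite e; ring.
have f0 : f`_n.+1 != 0.
  by have := lead_coef_eq0 f; rewrite lead_coefE sf /= => ->;
    rewrite -size_poly_eq0 sf.
apply: (normal_pair_eq0 (E := f`_n.+1) (n := n.+1) (z :=
  fun b => z b - n.+1%:R * sigma b)
  (e := lie_weight h0 (m - chi *+ n.+1))) => //.
- by rewrite -mulr_natl mulf_neq0 // ((pcharf0P K).1 charK0).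
- move=> b; have /(congr1 (fun g : {poly B} => g`_n.+1)) := zP b.
  rewrite (coef_oreC oreP) coefCM [f`_n.+2]nth_default ?sf // mulr0 mul0rn
    addr0.
  by rewrite mulrBl => <-; rewrite -mulr_natl; ring.
- exact/sigma_degree/has_degree_coef.
- by move=> b; rewrite s_normal subrK.
- by rewrite (sigma_degree s_degree) -lie_weight_X -lie_weightMn -lie_weightD
  subrK.
Qed.

Lemma linear_dvd_normal p n m :
  size p = n.+2 -> (forall b, principal p (brR p b%:P)) ->
  has_degree actR m p ->
  exists N, principal v ((u ^+ N)%:P * p).
Proof.
move=> sp p_normal p_degree; have [N [q [s e]]] := linear_pseudo_division c p
  u0.
exists N; exists q; rewrite e.
rewrite (_ : s = 0) ?addr0 //;
  apply: (linear_remainder_eq0 (n := n) (m := mu *+ N + m)) e.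
- by rewrite size_Cmul // expf_neq0.
- move=> b; elim: N => [|N [w IH]]; first by rewrite expr0 mul1r.
  exists ((zu b)%:P + w); rewrite exprS polyCM -mulrA (oreMl oreP) IH
    (oreC oreP) u_normal.
  by rewrite polyCM; ring.
- apply: (has_degreeM actRP) p_degree; apply/has_degree_polyAlgC.
  exact: (has_degreeX actBP) u_degree.
Qed.

Hypothesis v_saturated : forall f, principal v (u%:P * f) -> principal v f.

Lemma linear_poisson_prime : homogeneous_poisson_prime brR actR v.
Proof.
have v0 : v != 0 by rewrite -size_poly_gt0 size_linear.
split; last first.
  by right; split=> //; exists (torus_char (chi + mu)); exact: linear_degree.
split=> //; first exact: linear_normal.
exact: quotient_is_domain_linear.
Qed.

Lemma linear_associate p : homogeneous_poisson_prime brR actR p ->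
  (1 < size p)%N -> associate p v.
Proof.
move=> [[p0 p_normal p_prime] [pE|peig]] sp; first by rewrite pE eqxx in p0.
have [m p_degree] := eigenvector_has_degree charK0 actRP
  (cauchon_rational cauP) peig.
case sE : (size p) sp => [|[|n]] // _.
have [N vp] := linear_dvd_normal sE (fun b => p_normal b%:P) p_degree.
apply: prime_divisor_associate => //.
  by move/(principal_linear_polyC u0)/eqP; rewrite oner_eq0.
elim: N vp => [|N IH]; first by rewrite expr0 mul1r.
by rewrite exprS polyCM -mulrA => /v_saturated.
Qed.

End Linear.

(** ** Normal elements whose leading coefficient is killed by delta *)

(** The coefficients of [x^(n + 1)] and [x^n] in the normality relation express
[(n + 1) E delta b] by brackets with the leading coefficient [E] and the next
one [a]. At [b = E] this determines the multiplier of [E] at [a], and at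
[b = a] it becomes [(n + 1) E delta(a) = lam a^2]. If [a] had height [k], the
right-hand side would have height [2 k] and the left-hand side less than
[k]. *)
Lemma delta_eq0_of_high_normal p n m : locally_nilpotent delta ->
  size p = n.+2 -> (forall b, principal p (brR p b%:P)) ->
  has_degree actR m p ->
  delta p`_n.+1 = 0 -> forall b, delta b = 0.
Proof.
move=> nild sp p_normal p_degree dE.
have derd := (ore_delta oreP).1; have brP := ore_bracketB oreP.
have [z zP] := choice (fun b => ore_normal_scalar oreP (p_normal b)).
set E := p`_n.+1 in dE; set a := p`_n.
have E0 : E != 0.
  by have := lead_coef_eq0 p; rewrite lead_coefE sp /= => ->;
    rewrite -size_poly_eq0 sp.
have n0 : n.+1%:R != 0 :> B by exact: (alg_natr_neq0 B charK0).
pose logE b := z b - n.+1%:R * sigma b.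
have brE b : brB E b = logE b * E.
  have /(congr1 (fun g : {poly B} => g`_n.+1)) := zP b.
  rewrite (coef_oreC oreP) coefCM [p`_n.+2]nth_default ?sp // mulr0 mul0rn
    addr0.
  by rewrite /logE -/E mulrBl => <-; rewrite -mulr_natl; ring.
have bra b : n.+1%:R * E * delta b = (logE b + sigma b) * a - brB a b.
  have /(congr1 (fun g : {poly B} => g`_n)) := zP b.
  rewrite (coef_oreC oreP) coefCM -/E -/a -mulr_natl
    -(mulr_natl (delta b * _)) => e.
  transitivity (z b * a - brB a b - n%:R * (sigma b * a)); first by rewrite -e;
    ring.
  by rewrite /logE mulrSr; ring.
have wE := sigma_degree (has_degree_coef n.+1 p_degree); rewrite -/E in wE.
have wa := sigma_degree (has_degree_coef n p_degree); rewrite -/a in wa.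
have wD : lie_weight h0 (m - chi *+ n) = lie_weight h0 (m - chi *+ n.+1) + lam.
  by rewrite -lie_weight_X -lie_weightD mulrSr opprD addrA subrK.
set e := (lie_weight h0 (m - chi *+ n.+1))%:A : B.
have sE : sigma E = e * E by rewrite wE mulr_algl.
have sa : sigma a = (e + lam%:A) * a by rewrite wa wD -[LHS]mulr_algl scalerDl.
have logEE : logE E = 0 by apply: (mulIf E0);
  rewrite -brE (poisson_alt brP) mul0r.
have logEa : logE a = - (e * a).
  apply: (mulIf E0); rewrite -brE (br_antisym brP) mulNr; congr (- _).
  by have := bra E; rewrite dE mulr0 logEE sE => /eqP;
    rewrite eq_sym subr_eq0 => /eqP <-; ring.
have daa : n.+1%:R * E * delta a = lam%:A * (a * a).
  by rewrite bra logEa sa (poisson_alt brP); ring.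
have a0 : a = 0.
  apply/eqP; apply: contraT => a0; have [k [ak akS]] := lnd_height nild a0.
  have iterE j : iter j delta (n.+1%:R * E * delta a) = n.+1%:R * E * iter
    j.+1 delta a.
    elim: j => [//|j IH]; rewrite iterS IH (derM derd) (derM derd n.+1%:R) dE.
    by rewrite -[n.+1%:R]/(1 *+ n.+1) (derMn derd) (der1 derd) mul0rn mul0r
      mulr0 addr0 mul0r add0r.
  have iterL j : iter j delta (lam%:A * (a * a)) = lam%:A * iter j delta
    (a * a).
    by elim: j => [//|j IH]; rewrite !iterS IH (derM derd) (der_alg derd)
      mul0r add0r.
  have := lnd_height_mul charK0 derd ak akS ak akS.
  have := iterE (k + k)%N; rewrite daa iterL -addnS.
  rewrite [iter (k + k.+1) delta a](der_iterD_eq0 derd) // mulr0.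
  move/eqP; rewrite mulf_eq0 scaler_eq0 oner_eq0 orbF (negPf lam_neq0) /= =>
    /eqP ->.
  by rewrite eqxx.
move=> b; apply: (mulfI (mulf_neq0 n0 E0)).
by rewrite bra a0 (der0 (poisson_deriv_l brP b)) !mulr0 subr0.
Qed.

End CauchonWeights.

(** * The classification *)

Lemma fraction_numden (R : idomainType) (f : {fraction R}) :
  f * tofrac \d_(repr f) = tofrac \n_(repr f).
Proof.
rewrite -{1}[f]reprK; unlock tofrac; rewrite -[LHS]FracField.pi_mul.
apply/eqmodP; rewrite /= FracField.equivfE /FracField.mulf.
have d0 := denom_ratioP (repr f).
by rewrite !numden_Ratio ?mulr1 ?oner_eq0 // mulrC.
Qed.

(** The action on fractions is computed on a chosen representative [n / d] of
[c / u]; the relation [c d = u n] is preserved by the torus. *)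
Lemma frac_act_degree (K : fieldType) r (B : idomainAlgType K) br
    (act : torus K r -> B -> B) (m chi : 'rV[int]_r) (u c : B) :
  is_poisson_action br act -> u != 0 ->
  has_degree act m u -> has_degree act (chi + m) c ->
  has_degree (frac_act act) chi ((toFracAlg u)^-1 * toFracAlg c).
Proof.
move=> actP u0 du dc h; set w := _ * _.
rewrite /frac_act; set q := repr _.
have wq : w * toFracAlg \d_q = toFracAlg \n_q by exact:
  (fraction_numden (w : {fraction B})).
have d0 : \d_q != 0 by exact: denom_ratioP.
have tf0 (b : B) : b != 0 -> toFracAlg b != 0 by rewrite /toFracAlg tofrac_eq0.
have act0 (b : B) : b != 0 -> act h b != 0.
  by apply: contraNneq => b0; apply/eqP/(act_inj actP (h := h));
    rewrite b0 (act0 actP).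
have cd : c * \d_q = u * \n_q.
  apply/eqP; rewrite -(tofrac_eq _ _); apply/eqP;
    rewrite !tofracM -/(toFracAlg _).
  rewrite -[tofrac \n_q]wq /w mulrA mulrA mulfV ?mul1r //; exact: tf0.
have : torus_char chi h *: (c * act h \d_q) = u * act h \n_q.
  apply: (scalerI (torus_char_neq0 m h));
    rewrite scalerA mulrC -torus_charD scalerAl -dc.
  by rewrite scalerAl -du -!(actM actP) cd.
rewrite -mulr_algl => /(congr1 (@toFracAlg K B));
  rewrite /toFracAlg !tofracM => e.
apply: (mulIf (tf0 _ (act0 _ d0))); rewrite mulfVK; last exact/tf0/act0.
apply: (mulfI (tf0 _ u0)); rewrite -[LHS]e /w.
rewrite -[_ *: (_^-1 * _)]/(tofrac (torus_char chi h)%:A * _) /toFracAlg.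
have := tf0 _ u0; rewrite /toFracAlg => tu0.
by rewrite !mulrA [tofrac u * _]mulrC mulfK.
Qed.

Lemma associate_polyAlgC (K : fieldType) (B : idomainAlgType K) (a b : B) :
  associate (polyAlgC a) (polyAlgC b) <-> associate a b.
Proof.
split=> [[w wU e]|[w wU ->]]; last first.
  by exists w%:P; [exact: (rmorph_unit polyC) | rewrite /polyAlgC polyCM].
have : (w : {poly B}) \is a GRing.unit by exact: wU.
rewrite poly_unitE => /andP[_ w0U]; exists (w : {poly B})`_0 => //.
have /(congr1 (fun p : {poly B} => p`_0)) := e.
by rewrite [_ * _](mulrC (w : {poly B})) coefCM coefC mulrC.
Qed.

Lemma associate_size (K : fieldType) (B : idomainAlgType K) (p q : polyAlg B) :
  associate p q -> size (p : {poly B}) = size (q : {poly B}).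
Proof.
case=> w wU ->; have : (w : {poly B}) \is a GRing.unit by exact: wU.
rewrite poly_unitE => /andP[/eqP w1 w0U].
rewrite [(w : {poly B})]size1_polyC ?w1 //
  -[LHS]/(size (((w : {poly B})`_0)%:P * (q : {poly B}))).
by rewrite size_Cmul //; apply: contraTneq w0U => ->; rewrite unitr0.
Qed.

Section Classification.
Variables (K : fieldType) (r : nat) (B : idomainAlgType K).
Variables (brB : B -> B -> B) (sigma delta : B -> B).
Variable brR : polyAlg B -> polyAlg B -> polyAlg B.
Variables (actB : torus K r -> B -> B).
Variables (actR : torus K r -> polyAlg B -> polyAlg B).
Hypothesis charK0 : [pchar K] =i pred0.
Hypothesis cauP : is_poisson_cauchon brB sigma delta brR actB actR.
Hypothesis actBP : is_poisson_action brB actB.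

Let oreP := cauchon_ore cauP.
Let derd := (ore_delta oreP).1.

(** The Poisson-primes of [B] that remain Poisson-prime in [R]. *)
Definition persistent_prime (c : B) : Prop :=
  homogeneous_poisson_prime brB actB c /\ principal c (delta c).

Lemma associate_persistent (a b : B) :
  associate a b -> principal a (delta a) -> principal b (delta b).
Proof.
case=> w wU -> [q]; rewrite (derM derd) => e.
exists (w^-1 * (q * w - delta w)).
by apply: (mulrI wU); rewrite -mulrA mulVKr // -[LHS](addKr (delta w * b)) e;
  ring.
Qed.

Lemma homogeneous_polyAlgC (b : B) :
  homogeneous actB b <-> homogeneous actR (polyAlgC b).
Proof.
split=> -[b0|/(polyAlgC_eigenvector cauP)]; try by right.
  by left; rewrite b0.
by left; apply: polyC_inj.
Qed.

Lemma sigma_homogeneous (b : B) :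
  is_eigenvector actB b -> principal b (sigma b).
Proof.
move=> /(eigenvector_has_degreeB charK0 cauP)[m bm].
have [h0 [D [lam [DP Ds _ _]]]] := cauchon_lie cauP.
exists (lie_weight h0 m)%:A; rewrite mulr_algl;
  exact: (sigma_degree cauP DP Ds).
Qed.

Lemma persistent_prime_polyAlgC (b : B) :
  persistent_prime b <-> homogeneous_poisson_prime brR actR (polyAlgC b).
Proof.
split=> [[[bprime bhom] bd]|[bprime bhom]].
- split; last exact/homogeneous_polyAlgC.
  apply: (ore_prime_polyC oreP) => //; apply: sigma_homogeneous.
  by case: bhom => // b0; case: bprime; rewrite b0 eqxx.
- have [bprimeB bd] := ore_prime_polyC_inv oreP bprime.
  by split=> //; split=> //; apply/homogeneous_polyAlgC.
Qed.

Lemma lists_constant (J : Type) (w : J -> B) :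
  lists_up_to_associates persistent_prime w ->
  (forall p : polyAlg B, homogeneous_poisson_prime brR actR p ->
     (size (p : {poly B}) <= 1)%N) ->
  lists_up_to_associates (homogeneous_poisson_prime brR actR)
    (fun j => polyAlgC (w j)).
Proof.
move=> [wP winj wall] low; split=> [j|i j|p pP].
- exact/persistent_prime_polyAlgC.
- by move/associate_polyAlgC/winj.
- have pE : p = polyAlgC (p : {poly B})`_0 by apply: size1_polyC; exact: low.
  rewrite pE in pP; have [j pj] := wall _ ((persistent_prime_polyAlgC _).2 pP).
  by exists j; rewrite pE; apply/associate_polyAlgC.
Qed.

Lemma lists_constant_and (J : Type) (w : J -> B) (v : polyAlg B) :
  lists_up_to_associates persistent_prime w ->
  homogeneous_poisson_prime brR actR v -> size (v : {poly B}) = 2 ->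
  (forall p : polyAlg B, homogeneous_poisson_prime brR actR p ->
     (1 < size (p : {poly B}))%N -> associate p v) ->
  lists_up_to_associates (homogeneous_poisson_prime brR actR)
    (fun o => if o is Some j then polyAlgC (w j) else v).
Proof.
move=> [wP winj wall] vP v2 vall; split=> [[j|//]|[i|] [j|]|p pP] //.
- exact/persistent_prime_polyAlgC.
- by move/associate_polyAlgC/winj => ->.
- by move/associate_size; rewrite v2 => /eqP; have := size_polyC_leq1 (w i);
  case: size => [|[]].
- by move/associate_size; rewrite v2 => /esym/eqP;
  have := size_polyC_leq1 (w j); case: size => [|[]].
- have [p1|/(vall p pP) pv] := leqP (size (p : {poly B})) 1;
  last by exists None.
  have pE : p = polyAlgC (p : {poly B})`_0 by exact: size1_polyC.
  rewrite pE in pP; have [j pj] := wall _ ((persistent_prime_polyAlgC _).2 pP).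
  by exists (Some j); rewrite pE; apply/associate_polyAlgC.
Qed.

(** The leading coefficient [E] is Poisson-normal in [B], so a multiple of it is
a product of Poisson-prime eigenvectors, which [delta] kills. As the kernel of
a locally nilpotent derivation is factorially closed, [delta E = 0]. *)
Lemma delta_eq0_of_high_prime (p : polyAlg B) : noetherian B ->
  is_H_poisson_UFD brB actB ->
  (forall c, homogeneous_poisson_prime brB actB c -> principal c (delta c)) ->
  homogeneous_poisson_prime brR actR p -> (1 < size (p : {poly B}))%N ->
  forall b, delta b = 0.
Proof.
move=> noethB ufdB pers [[p0 p_normal _] phom] p1.
have nild := cauchon_nilpotent cauP; have brP := ore_bracketB oreP.
have [chi chiX] := cauchon_has_degree_X charK0 cauP.
have [h0 [D [lam [DP Ds DX lam0]]]] := cauchon_lie cauP.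
have [m pm] : exists m, has_degree actR m p.
  apply: (eigenvector_has_degree charK0 (cauchon_action cauP)
    (cauchon_rational cauP)).
  by case: phom => // pE; rewrite pE eqxx in p0.
case sp : (size (p : {poly B})) p1 => [|[|n]] // _.
apply: (delta_eq0_of_high_normal charK0 cauP actBP chiX DP Ds DX lam0 nild sp
  _ pm).
  by move=> b; exact: p_normal.
set E := _`_n.+1; have E0 : E != 0.
  have := lead_coef_eq0 (p : {poly B}); rewrite lead_coefE sp /= => ->.
  by rewrite -size_poly_eq0 sp.
have Em := has_degree_coef cauP actBP chiX n.+1 pm; rewrite -/E in Em.
have E_normal b : principal E (brB E b).
  have [z /(congr1 (fun g : {poly B} => g`_n.+1))] := ore_normal_scalar oreP
    (p_normal b%:P).
  rewrite (coef_oreC oreP) coefCM [_`_n.+2]nth_default ?sp // mulr0 mul0rn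
    addr0 -/E => e.
  by exists (z - sigma b *+ n.+1); rewrite mulrBl -e mulrnAl addrK.
have E_eig : is_eigenvector actB E by split=> //;
  exists (torus_char (m - chi *+ n.+1)).
have [s [sP [q sE]]] := stable_poisson_ideal_contains_prime_product brP actBP
  noethB ufdB
  (normal_eigenvector_ideal brP actBP E_eig E_normal)
  (ex_intro2 _ _ E (ex_intro _ 1 (esym (mul1r E))) E0).
have dprod : delta (\prod_(c <- s) c) = 0.
  rewrite big_seq; apply: (big_ind (fun x => delta x = 0)) => [|x y dx dy|c cs].
  - exact: der1 derd.
  - by rewrite (derM derd) dx dy mul0r mulr0 addr0.
  - exact: (lnd_dvd_eq0 charK0 derd nild (pers c (sP c cs))).
have prod0 : \prod_(c <- s) c != 0.
  rewrite big_seq; apply: (big_ind (fun x => x != 0)) => [|x y|c cs].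
  - exact: oner_neq0.
  - exact: mulf_neq0.
  - by have [[]] := sP c cs.
by rewrite sE mulrC in dprod prod0;
  exact: (lnd_ker_factor charK0 derd nild prod0 dprod).
Qed.

End Classification.

Theorem theorem4p13 (K : fieldType) (charK0 : [pchar K] =i pred0) (r : nat)
    (B : idomainAlgType K) (brB : B -> B -> B) (sigma delta : B -> B)
    (brR : polyAlg B -> polyAlg B -> polyAlg B)
    (actB : torus K r -> B -> B) (actR : torus K r -> polyAlg B -> polyAlg B)
    (cauchonR : is_poisson_cauchon brB sigma delta brR actB actR)
    (noethB : noetherian B) (ufdB : is_H_poisson_UFD brB actB)
    (I : Type) (u : I -> B)
    (listu : lists_up_to_associates (homogeneous_poisson_prime brB actB) u) :
  let listsR (J : Type) (v : J -> polyAlg B) :=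
    lists_up_to_associates (homogeneous_poisson_prime brR actR) v in
  [\/ (* (i) *)
      exists (i0 : I) (c0 : B),
        let w := (toFracAlg (u i0))^-1 * toFracAlg c0 in
        [/\ w != 0,
            exists2 chi : 'rV[int]_r,
              has_degree actR chi polyAlgX & has_degree (frac_act actB) chi w
          & listsR (option {i : I | i <> i0})
              (fun o => if o is Some i then polyAlgC (u (sval i))
                        else polyAlgC (u i0) * polyAlgX - polyAlgC c0)],
      (* (ii) *)
      listsR (option I) (fun o => if o is Some i then polyAlgC (u i)
                                  else polyAlgX)
    | (* (iii) *)
      listsR I (fun i => polyAlgC (u i))].
Proof.
move=> listsR; have [brP actP _] := ufdB; have [uP uinj uall] := listu.
have oreP := cauchon_ore cauchonR; have ders := (ore_sigma oreP).1.
have nild := cauchon_nilpotent cauchonR.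
have [chi chiX] := cauchon_has_degree_X charK0 cauchonR.
have [h0 [D [lam [DP Ds DX lam0]]]] := cauchon_lie cauchonR.
have sigma_delta := sigma_delta_comm charK0 cauchonR actP chiX DP Ds DX.
have [[i0 ui0]|allpers] :=
  pselect (exists i0, ~ principal (u i0) (delta (u i0))).
  apply: Or31.
  have [[u0 u_normal u_prime] u_hom] := uP i0.
  have u_eig : is_eigenvector actB (u i0).
    by case: u_hom => // uE; rewrite uE eqxx in u0.
  have [mu u_degree] := eigenvector_has_degreeB charK0 cauchonR u_eig.
  have [z zP] := choice u_normal.
  have [n [un unS]] := lnd_height nild u0.
  have sigma_u := sigma_degree cauchonR DP Ds u_degree.
  pose c := shift_num delta lam (u i0).
  have delta_u : delta (u i0) = lam *: c by exact: delta_eq_shift_num.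
  have br_c : forall b, brB c b = u i0 * delta b + (z b + sigma b) * c.
    move=> b.
    exact: (bracket_shift_num charK0 brP ders (ore_delta oreP) nild lam0
      sigma_delta zP sigma_u un unS u_prime ui0).
  have delta_c : delta c = 0.
    exact: (delta_shift_num charK0 brP ders (ore_delta oreP) nild lam0
      sigma_delta zP sigma_u un unS u_prime ui0).
  have c_degree : has_degree actB (chi + mu) c.
    by apply: (has_degreeZ actP); exact: (delta_degree cauchonR actP chiX).
  have u_ndvd_c : ~ principal (u i0) c.
    move=> [q cE]; apply: ui0; exists (lam *: q).
    by rewrite delta_u cE scalerAl.
  have c0 : c != 0.
    by apply/eqP => cE; apply: u_ndvd_c; exists 0; rewrite cE mul0r.
  exists i0, c; split.
  - by rewrite mulf_neq0 ?invr_eq0 /toFracAlg ?tofrac_eq0.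
  - by exists chi => //; exact: (frac_act_degree actP u0 u_degree c_degree).
  have sat := linear_saturated u_prime u0 u_ndvd_c.
  apply: (lists_constant_and charK0 cauchonR
    (w := fun i : {i : I | i <> i0} => u (sval i))).
  - split=> [[i ii0]|[i ii0] [j ji0] /uinj/= ij|b [bprime bpers]].
    + split=> //=; have [[ui_neq0 ui_normal [ui1 ui_prime]] ui_hom] := uP i.
      have ui_eig : is_eigenvector actB (u i).
        by case: ui_hom => // uE; rewrite uE eqxx in ui_neq0.
      have ui_ndvd : ~ principal (u i) (u i0).
        by move/(prime_divisor_associate ui1 u0 u_prime)/uinj => /esym.
      (* [z (u i) * u i0 = {u i0, u i}] is a multiple of the prime
         [u i], which does not divide [u i0]. *)
      have ui_z : principal (u i) (z (u i)).
        have [q qE] := ui_normal (u i0).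
        have [||] // := ui_prime (z (u i)) (u i0).
        by exists (- q); rewrite -zP (br_antisym brP) qE mulNr.
      (* In [u i0 * delta (u i) = {c, u i} - (z (u i) + sigma (u i)) * c]
         every term on the right is a multiple of [u i]. *)
      have [I0 ID IM] := principal_ideal (u i).
      have [|//|//] := ui_prime (u i0) (delta (u i)).
      rewrite -(addrK ((z (u i) + sigma (u i)) * c) (_ * _)) -br_c.
      apply: ideal_sub; first exact: principal_ideal.
        have [q qE] := ui_normal c; exists (- q).
        by rewrite (br_antisym brP) qE mulNr.
      rewrite mulrC; apply: (IM); apply: ID => //.
      exact: (sigma_homogeneous charK0 cauchonR).
    + exact: eq_exist.
    + have [j bj] := uall b bprime.
      have ji0 : j <> i0.
        move=> ji0; apply: ui0; rewrite ji0 in bj.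
        exact: (associate_persistent cauchonR bj).
      by exists (exist _ j ji0).
  - exact: (linear_poisson_prime cauchonR chiX DP Ds DX u0 zP u_degree
             c_degree br_c delta_u delta_c sat).
  - exact: size_linear.
  - exact: (linear_associate charK0 cauchonR actP chiX DP Ds DX lam0 u0 zP
    u_degree c_degree br_c sat).
have pers c : homogeneous_poisson_prime brB actB c -> principal c (delta c).
  move=> cP; have [i /associate_sym ci] := uall c cP.
  apply: (associate_persistent cauchonR ci).
  by apply: contrapT => ui; apply: allpers; exists i.
have list_pers : lists_up_to_associates (persistent_prime brB delta actB) u.
  by split=> [i||p [/uall]] //; split=> //; exact: pers.
have [delta0|delta0] := pselect (forall b, delta b = 0); last first.
  apply: Or33; apply: (lists_constant charK0 cauchonR list_pers) => p pP.
  rewrite leqNgt; apply: contra_notN delta0 => p1.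
  exact: (delta_eq0_of_high_prime charK0 cauchonR actP noethB ufdB pers pP p1).
apply: Or32.
(* The element [x] is the case [u = 1], [c = 0] of a linear polynomial. *)
have XE : (1 : B)%:P * 'X - (0 : B)%:P = polyAlgX :> {poly B}.
  by rewrite polyC0 subr0 mul1r.
have one0 : (1 : B) != 0 := oner_neq0 B.
have one_normal b : brB 1 b = (fun=> 0) b * 1.
  by rewrite [RHS]mul0r; exact: der1 (poisson_deriv_l brP b).
have one_degree : has_degree actB 0 1 by rewrite -(scale1r 1);
  exact: has_degree_alg actP 1.
have zero_degree : has_degree actB (chi + 0) 0 by exact: (has_degree0 actP).
have br_zero b : brB 0 b = 1 * delta b + (0 + sigma b) * 0.
  by rewrite delta0 !mulr0 addr0; exact: der0 (poisson_deriv_l brP b).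
have delta1 : delta 1 = lam *: 0 by rewrite delta0 scaler0.
have sat f : principal ((1 : B)%:P * 'X - 0%:P) (1%:P * f) ->
  principal ((1 : B)%:P * 'X - 0%:P) f.
  by rewrite polyC1 !mul1r.
apply: (lists_constant_and charK0 cauchonR (w := u) (v := polyAlgX) list_pers).
- rewrite -XE; exact: (linear_poisson_prime cauchonR chiX DP Ds DX one0
    one_normal one_degree zero_degree br_zero delta1 (delta0 0) sat).
- exact: size_polyX.
- rewrite -XE; exact: (linear_associate charK0 cauchonR actP chiX DP Ds DX
    lam0 one0 one_normal one_degree zero_degree br_zero sat).
Qed.
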